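(* Let $(Y,\xi)$ be a contact manifold, let $N\subset Y$ be locally closed, and suppose that $p\in N$ is locally rigid with respect to $N$. If $\psi\colon Y\to Y$ is a contact homeomorphism that is bounded below near $p$, then $\psi(p)$ is locally rigid with respect to $\psi(N)$.
   Context: A contact homeomorphism of $(Y,\xi)$ is a homeomorphism $\psi\colon Y\to Y$ that is the limit of a sequence of contactomorphisms of $(Y,\xi)$ with respect to the compact-open topology (''$C^0$-convergence''). A contact form for $\xi$ on a set is a one-form $\alpha$ defined there with $\ker\alpha=\xi$. A contact homeomorphism $\psi$ is bounded below near $p\in Y$ if there are (i) a sequence $\{\psi_m\}$ of contactomorphisms of $Y$ $C^0$-converging to $\psi$; (ii) a neighborhood $\mathcal{O}$ of $p$ such that the closure $\bar{\mathcal{O}}$ is compact and $\xi|_{\bar{\mathcal{O}}}$ is coorientable; and (iii) contact forms $\alpha$ and $\alpha'$ for the restrictions of $\xi$ to neighborhoods of $\bar{\mathcal{O}}$ and $\psi(\bar{\mathcal{O}})$, respectively, such that $(\psi_m^*\alpha')|_{\bar{\mathcal{O}}}=f_m\alpha|_{\bar{\mathcal{O}}}$ where $\inf_{m\in\mathbb{Z}_+}\inf_{q\in\bar{\mathcal{O}}}|f_m(q)|>0$. Disjunction energy: for an open subset $W$ of $Y$, let $\mathcal{C}_W(Y,\xi)$ be the space of smooth time-dependent contact vector fields $\mathbb{V}=(V_t)_{t\in[0,1]}$ having compact support contained in $[0,1]\times W$, and write $\psi^{\mathbb{V},t}$ for the time-$t$ flow. Given $N\subset Y$, open sets $U,W$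 with $\bar U\subset W$ and $N\cap W$ closed in $W$, and a one-form $\alpha$ on $W$ with $\ker\alpha=\xi|_W$, set $$e_\alpha^W(U,N)=\inf\left\{\int_0^1\max_W|\alpha(V_t)|\,dt\ :\ \mathbb{V}=(V_t)_{t\in[0,1]}\in\mathcal{C}_W(Y,\xi),\ \psi^{\mathbb{V},1}(\bar U)\cap N=\varnothing\right\}$$ (with $\inf\varnothing=+\infty$). Local rigidity: for $N\subset Y$ locally closed and $p\in N$, $p$ is locally rigid with respect to $N$ if there is an (open) neighborhood $W$ of $p$ in $Y$ having compact closure such that $N\cap W$ is closed in $W$ and, for every (open) neighborhood $U$ of $p$ with $\bar U\subset W$, we have $e_\alpha^W(U,N)>0$ for one (equivalently any) contact form $\alpha$ for $\xi|_W$ that extends continuously to $\bar W$ as a nowhere-vanishing form representing $\xi$ there. *)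

(* Defs.v *)
From HB Require Import structures.
From mathcomp Require Import all_boot all_order all_algebra all_fingroup.
From mathcomp Require Import all_classical all_reals all_analysis.

Set Implicit Arguments.
Unset Strict Implicit.
Unset Printing Implicit Defensive.

Import Order.TTheory GRing.Theory Num.Theory.
Import numFieldNormedType.Exports.

Local Open Scope classical_set_scope.
Local Open Scope ring_scope.

(* Meaningful for open A: 'D_v and differentiability look at f near each point
   of A only, so the values of f away from A are irrelevant. *)
Fixpoint Ck (R : realType) (E : normedModType R) (k : nat) (A : set E)
    (f : E -> R) : Prop :=
  match k with
  | 0%N => forall x, A x -> {for x, continuous f}
  | k'.+1 => (forall x, A x -> differentiable f x) /\
             (forall v : E, Ck k' A ('D_v f))
  end.

Definition Csmooth (R : realType) (E : normedModType R) (A : set E)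
  (f : E -> R) : Prop := forall k, Ck k A f.

(* chart_map and chart_inv are total; only their restrictions to chart_dom and
   chart_img are meaningful. *)
Record chart (R : realType) (d : nat) (T : topologicalType) := Chart {
  chart_dom : set T;
  chart_map : T -> 'rV[R]_d;
  chart_inv : 'rV[R]_d -> T }.

Definition chart_img (R : realType) (d : nat) (T : topologicalType)
  (c : chart R d T) : set 'rV[R]_d := chart_map c @` chart_dom c.

Definition is_chart (R : realType) (d : nat) (T : topologicalType)
    (c : chart R d T) : Prop :=
  [/\ open (chart_dom c),
      open (chart_img c),
      forall y, chart_dom c y -> chart_inv c (chart_map c y) = y,
      forall y, chart_dom c y -> {for y, continuous (chart_map c)} &
      forall x, chart_img c x -> {for x, continuous (chart_inv c)}].

Definition chart_compatible (R : realType) (d : nat) (T : topologicalType)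
    (c c' : chart R d T) : Prop :=
  forall i : 'I_d,
    Csmooth (chart_map c @` (chart_dom c `&` chart_dom c'))
            (fun x => chart_map c' (chart_inv c x) 0 i).

Record smoothManifold (R : realType) (d : nat) := SmoothManifold {
  manifold_space :> topologicalType;
  atlas : set (chart R d manifold_space);
  manifold_hausdorff : hausdorff_space manifold_space;
  manifold_second_countable : @second_countable manifold_space;
  atlas_chart : forall c, atlas c -> is_chart c;
  atlas_cover : forall y, exists2 c, atlas c & chart_dom c y;
  atlas_compatible : forall c c', atlas c -> atlas c' -> chart_compatible c c' }.

Section Manifold.
Variables (R : realType) (d : nat) (Y : smoothManifold R d).

(* A is meant to be open. *)
Definition smooth_on (A : set Y) (f : Y -> R) : Prop :=
  forall c, atlas c ->
    Csmooth (chart_map c @` (chart_dom c `&` A)) (f \o chart_inv c).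

Definition smooth_near (y : Y) (f : Y -> R) : Prop :=
  exists2 U, open_nbhs y U & smooth_on U f.

(* The same for functions of (t, z) in R x Y, near (t, y). *)
Definition smooth_near_time (t : R) (y : Y) (F : R -> Y -> R) : Prop :=
  exists I U, [/\ open_nbhs t I, open_nbhs y U &
    forall c, atlas c ->
      Csmooth [set p : R * 'rV[R]_d |
                I p.1 /\ (chart_map c @` (chart_dom c `&` U)) p.2]
              (fun p => F p.1 (chart_inv c p.2))].

(* A tangent vector at y acts on functions that are smooth near y.  So that
   Leibniz equality is equality of tangent vectors, it is set to 0 on all
   other functions. *)
Definition germ_functional := (Y -> R) -> R.

Definition partial_at (y : Y) (c : chart R d Y) (w : 'rV[R]_d) :
    germ_functional :=
  fun f => if `[< smooth_near y f >]
           then 'D_w (f \o chart_inv c) (chart_map c y) else 0.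

(* T_y Y: the operators sum_i w_i d/dx_i at y, in local coordinates. *)
Definition tangent (y : Y) : set germ_functional :=
  [set v | exists c w, [/\ atlas c, chart_dom c y & v = partial_at y c w]].

Definition zero_vector : germ_functional := fun=> 0.

Definition vector_field := Y -> germ_functional.

Definition smooth_field_near (y : Y) (X : vector_field) : Prop :=
  exists2 U, open_nbhs y U &
    forall z, U z -> tangent z (X z) /\
      (forall f, smooth_near z f -> smooth_near z (fun x => X x f)).

Definition bracket (X Z : vector_field) : vector_field :=
  fun y f => if `[< smooth_near y f >]
             then X y (fun z => Z z f) - Z y (fun z => X z f) else 0.

(* A one-form is a total function; it is only constrained on the set where
   the form is considered, and on genuine tangent vectors. *)
Definition one_form := Y -> germ_functional -> R.

Definition linear_at (y : Y) (alpha : one_form) : Prop :=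
  forall (a : R) (v w : germ_functional), tangent y v -> tangent y w ->
    alpha y (fun f => a * v f + w f) = a * alpha y v + alpha y w.

Definition smooth_form_on (A : set Y) (alpha : one_form) : Prop :=
  forall y, A y -> linear_at y alpha /\
    (forall X, smooth_field_near y X ->
       smooth_near y (fun z => alpha z (X z))).

Definition continuous_form_on (A : set Y) (alpha : one_form) : Prop :=
  forall y, A y -> linear_at y alpha /\
    (forall X, smooth_field_near y X ->
       (fun z => alpha z (X z)) @ within A (nbhs y) --> alpha y (X y)).

Definition ker_form (alpha : one_form) (y : Y) : set germ_functional :=
  [set v | tangent y v /\ alpha y v = 0].

Definition nonvanishing_on (A : set Y) (alpha : one_form) : Prop :=
  forall y, A y -> exists2 v, tangent y v & alpha y v != 0.

Definition ext_d (alpha : one_form) (X Z : vector_field) (y : Y) : R :=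
  X y (fun z => alpha z (Z z)) - Z y (fun z => alpha z (X z))
  - alpha y (bracket X Z y).

Definition pushforward (psi : Y -> Y) (v : germ_functional) :
  germ_functional := fun f => v (f \o psi).

Definition smooth_map (psi : Y -> Y) : Prop :=
  continuous psi /\
  forall y f, smooth_near (psi y) f -> smooth_near y (f \o psi).

Definition homeomorphism (psi : Y -> Y) : Prop :=
  continuous psi /\
  exists phi : Y -> Y, [/\ continuous phi, cancel psi phi & cancel phi psi].

Definition diffeomorphism (psi : Y -> Y) : Prop :=
  smooth_map psi /\
  exists phi : Y -> Y, [/\ smooth_map phi, cancel psi phi & cancel phi psi].

Definition time_field := R -> vector_field.

(* Smoothness on [0,1] x Y in the sense of manifolds with boundary: local
   existence of a smooth extension past t = 0 and t = 1. *)
Definition smooth_time_field (V : time_field) : Prop :=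
  forall (t : R) (y : Y), 0 <= t <= 1 -> tangent y (V t y) /\
    (forall f, smooth_near y f ->
      exists2 G : R -> Y -> R, smooth_near_time t y G &
        \forall p \near (t, y), 0 <= p.1 <= 1 -> G p.1 p.2 = V p.1 p.2 f).

Definition time_support (V : time_field) : set (R * Y) :=
  closure [set p : R * Y | 0 <= p.1 <= 1 /\ V p.1 p.2 <> zero_vector].

(* Phi t is the time-t flow of V for 0 <= t <= 1.  At t = 0 and t = 1 the
   (one-sided) differential equation follows by continuity. *)
Definition is_flow (V : time_field) (Phi : R -> Y -> Y) : Prop :=
  forall y : Y,
  [/\ Phi 0 y = y,
      {within `[0, 1], continuous (Phi ^~ y)} &
      forall (t : R) f, 0 < t < 1 -> smooth_near (Phi t y) f ->
        is_derive t (1 : R) (fun s => f (Phi s y)) (V t (Phi t y) f)].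

Definition closed_in (W A : set Y) : Prop :=
  exists2 C : set Y, closed C & A = C `&` W.

Definition locally_closed (N : set Y) : Prop :=
  exists2 O : set Y, open O & closed_in O N.

End Manifold.

(* (alpha /\ (d alpha)^n)(X_0, ..., X_2n) at y, up to a nonzero constant. *)
Definition wedge_top (R : realType) (n : nat)
    (Y : smoothManifold R n.*2.+1) (alpha : one_form Y)
    (X : 'I_n.*2.+1 -> vector_field Y) (y : Y) : R :=
  \sum_(s : 'S_n.*2.+1) (-1) ^+ s *
    (alpha y (X (s ord0) y) *
     \prod_(i < n) ext_d alpha (X (s (inord i.*2.+1)))
                               (X (s (inord i.*2.+2))) y).

Definition contact_condition (R : realType) (n : nat)
    (Y : smoothManifold R n.*2.+1) (alpha : one_form Y) (y : Y) : Prop :=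
  exists2 X : 'I_n.*2.+1 -> vector_field Y,
    forall i, smooth_field_near y (X i) & wedge_top alpha X y != 0.

Record contactManifold (R : realType) (n : nat) := ContactManifold {
  contact_space :> smoothManifold R n.*2.+1;
  xi : forall y : contact_space, set (germ_functional contact_space);
  xi_contact : forall y : contact_space,
    exists (U : set contact_space) (alpha : one_form contact_space),
      [/\ open_nbhs y U, smooth_form_on U alpha,
          forall z, U z -> ker_form alpha z = xi z &
          forall z, U z -> contact_condition alpha z] }.

Arguments xi {R n} _ _.

Section Contact.
Variables (R : realType) (n : nat) (Y : contactManifold R n).

Definition represents_on (A : set Y) (alpha : one_form Y) : Prop :=
  nonvanishing_on A alpha /\ forall y, A y -> ker_form alpha y = xi Y y.

Definition contact_form_on (A : set Y) (alpha : one_form Y) : Prop :=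
  smooth_form_on A alpha /\ represents_on A alpha.

Definition coorientable_on (A : set Y) : Prop :=
  exists2 beta : one_form Y, continuous_form_on A beta & represents_on A beta.

Definition contactomorphism (psi : Y -> Y) : Prop :=
  diffeomorphism psi /\
  forall y v, tangent y v ->
    (xi Y y v <-> xi Y (psi y) (pushforward psi v)).

Definition C0_cvg (psi_ : nat -> Y -> Y) (psi : Y -> Y) : Prop :=
  {compact-open, psi_ @ \oo --> psi}.

Definition contact_homeomorphism (psi : Y -> Y) : Prop :=
  homeomorphism psi /\
  exists2 psi_ : nat -> Y -> Y,
    (forall m, contactomorphism (psi_ m)) & C0_cvg psi_ psi.

Definition bounded_below_near (psi : Y -> Y) (p : Y) : Prop :=
  exists (psi_ : nat -> Y -> Y) (O : set Y),
  [/\ forall m, contactomorphism (psi_ m), C0_cvg psi_ psi,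
      nbhs p O, compact (closure O) & coorientable_on (closure O)] /\
  exists (G G' : set Y) (alpha alpha' : one_form Y) (f_ : nat -> Y -> R),
  [/\ open G /\ closure O `<=` G,
      open G' /\ psi @` closure O `<=` G',
      contact_form_on G alpha /\ contact_form_on G' alpha',
      forall m q, closure O q -> G' (psi_ m q) /\
        (forall v, tangent q v ->
           alpha' (psi_ m q) (pushforward (psi_ m) v)
           = f_ m q * alpha q v) &
      0 < inf [set r : R | exists m q, closure O q /\ r = `|f_ m q|]].

(* The Lie derivative of V preserves the sections of xi, i.e., V is an
   infinitesimal automorphism of xi. *)
Definition contact_field (V : vector_field Y) : Prop :=
  forall y X, smooth_field_near y X -> (\forall z \near y, xi Y z (X z)) ->
    xi Y y (bracket V X y).

Definition contact_time_field (W : set Y) (V : time_field Y) : Prop :=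
  [/\ smooth_time_field V,
      forall t : R, 0 <= t <= 1 -> contact_field (V t),
      compact (time_support V) &
      time_support V `<=` [set p | 0 <= p.1 <= 1 /\ W p.2]].

(* For V in contact_time_field W and W nonempty, the supremum over W is a
   maximum.  The flow Phi exists, and is unique on [0,1]. *)
Definition disjunction_energy (W : set Y) (alpha : one_form Y)
    (U N : set Y) : \bar R :=
  ereal_inf [set e | exists (V : time_field Y) (Phi : R -> Y -> Y),
    [/\ contact_time_field W V, is_flow V Phi,
        (Phi 1 @` closure U) `&` N = set0 &
        e = (\int[lebesgue_measure]_(t in `[0%R, 1%R])
               ereal_sup [set (`|alpha y (V t y)|)%:E | y in W])%E]].

Definition rigidity_form (W : set Y) (alpha : one_form Y) : Prop :=
  contact_form_on W alpha /\
  exists beta : one_form Y,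
    [/\ continuous_form_on (closure W) beta,
        represents_on (closure W) beta &
        forall y v, W y -> tangent y v -> beta y v = alpha y v].

Definition locally_rigid (N : set Y) (p : Y) : Prop :=
  exists W : set Y,
  [/\ open_nbhs p W, compact (closure W), closed_in W (N `&` W) &
      forall U : set Y, open_nbhs p U -> closure U `<=` W ->
        exists2 alpha : one_form Y, rigidity_form W alpha &
          (0 < disjunction_energy W alpha U N)%E].

End Contact.

(* Main.v *)
Require Import Defs.
From HB Require Import structures.
From mathcomp Require Import all_boot all_order all_algebra all_fingroup.
From mathcomp Require Import all_classical all_reals all_analysis.
From mathcomp Require Import ring lra.

(** Shrink the neighborhood of [p] to [W1] and set [W' = psi(W1)]; let [U'] be a
    neighborhood of [psi(p)] and [U] one of [p] with [psi(cl U)] inside [U'].  If a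
    contact isotopy generated by [V] in [W'] disjoins [cl U'] from [psi(N)], then for
    [m] large its conjugate by [psi_m] is supported in [W1] and disjoins [cl U] from
    [N]: the image of [cl U'] under the isotopy is compact in [W'], hence its image
    under [psi_m^-1], which converges uniformly on compact sets to [psi^-1], stays
    away from [N].  The generating field [psi_m^* V] satisfies
    [|alpha(psi_m^* V)| = |alpha'(V)| / |f_m|], so a positive lower bound for the
    [|f_m|] bounds the energy in [W'] from below by a multiple of the energy in [W].

    Compactness of the image of [cl U'] under the flow needs continuity of the flow
    in the initial condition, which follows from Gronwall's inequality in charts. *)

Set Implicit Arguments.
Unset Strict Implicit.
Unset Printing Implicit Defensive.

Import Order.TTheory GRing.Theory Num.Theory.
Import numFieldNormedType.Exports.

Local Open Scope classical_set_scope.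
Local Open Scope ring_scope.

(** * Functions of class C^k *)

Section Calculus.
Variable R : realType.

(** The form [alpha0] given by rigidity of [p] is unrelated to the form [alpha] of the lower bound,
    and the two are comparable only on compact sets. Hence [W1] is taken as the interior of a
    compact [K] lying both in [W] and in the neighborhood where the [f_m] are controlled. The
    resulting factor is [delta / C], with [delta] the infimum of the [|f_m|] and [C] a bound for
    [|alpha0|] by [|alpha|] on [K]. It depends neither on [m] nor on the isotopy, so each isotopy
    may be conjugated by an index [m] of its own and no limit of isotopies is taken. Since [N] is
    closed only relative to [W], the image of cl [U'] under the isotopy must remain in [W']; it
    does, because an orbit ending off the support of the field is constant. Convergence of the
    inverses is not part of the data: it is extracted from that of the [psi_m] by a connectedness
    argument in [Y]. Tangent vectors are functionals on functions and pushforward is precomposition,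
    so most conjugation identities amount to cancelling a map with its inverse. *)

Lemma near_eq_differentiable (V W : normedModType R) (f g : V -> W) (x : V) :
  (\forall z \near x, f z = g z) -> differentiable f x -> differentiable g x.
Proof.
move=> fg df.
have gx : g \o shift x = cst (g x) + 'd f x +o_ 0 id.
  apply/eqaddoP => e e0.
  have /eqaddoP/(_ e e0) := diff_locally df.
  rewrite -(nbhs_singleton fg).
  have : \forall z \near (0 : V), f (z + x) = g (z + x).
    by move: fg; rewrite (near_shift 0) subr0.
  by apply: filterS2 => z /= fgz; rewrite !fctE /= fgz.
have dg : 'd g x = 'd f x :> (V -> W).
  by apply: diff_unique gx; exact: diff_continuous.
by apply/diff_locallyP; rewrite dg; split => //; exact: diff_continuous.
Qed.

Variable E : normedModType R.
Implicit Types (f g : E -> R) (A B : set E).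

(** Directional derivatives are total functions and each clause of [Ck] concerns one point at a
    time, so the condition decouples over the points of [A]. This is what patches smoothness near
    each point into smoothness on a set. *)
Lemma Ck_pointwise k A f : Ck k A f <-> forall x, A x -> Ck k [set x] f.
Proof.
elim: k f => [|k IH] f /=.
  by split=> [fA x Ax _ ->|fA x Ax]; [exact: fA | exact: (fA x Ax x)].
split=> [[df Df] x Ax|fA].
  split=> [_ -> |v]; first exact: df.
  by move/IH : (Df v); apply.
split=> [x Ax|v]; first by have [+ _] := fA x Ax; apply.
by apply/IH => x Ax; have [_] := fA x Ax; apply.
Qed.

Lemma Ck_near_eq k A f g : (forall x, A x -> \forall z \near x, f z = g z) ->
  Ck k A f -> Ck k A g.
Proof.
elim: k f g => [|k IH] f g fg /=.
  move=> fA x Ax; have := fA _ Ax.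
  rewrite /prop_for /continuous_at (nbhs_singleton (fg _ Ax)).
  by apply: cvg_trans; apply: near_eq_cvg; apply: filterS (fg _ Ax) => z ->.
move=> [df Df]; split=> [x Ax|v].
  exact: near_eq_differentiable (fg _ Ax) (df _ Ax).
apply: (IH ('D_v f)) => // x Ax.
have /near_join := fg _ Ax.
by apply: filterS => z fgz; exact: near_eq_derive.
Qed.

Lemma CkS k A f : Ck k.+1 A f -> Ck k A f.
Proof.
elim: k f => [|k IH] f [df Df]; first by move=> x /df /differentiable_continuous.
by split=> // v; apply: IH.
Qed.

Lemma Ck_cst k A (a : R) : Ck k A (fun=> a).
Proof.
elim: k a => [|k IH] a /=; first by move=> x _; exact: cst_continuous.
split=> [x _|v]; first exact: differentiable_cst.
rewrite (_ : 'D_v _ = fun=> 0) //; apply/funext => x; exact: derive_cst.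
Qed.

Lemma open_nearP A (P : E -> Prop) : open A -> (forall x, A x -> P x) ->
  forall x, A x -> \forall z \near x, P z.
Proof. by move=> oA AP x Ax; apply: filterS AP _; exact: open_nbhs_nbhs. Qed.

Lemma CkD k A f g : open A -> Ck k A f -> Ck k A g -> Ck k A (fun x => f x + g x).
Proof.
move=> oA; elim: k f g => [|k IH] f g /=.
  by move=> fA gA x Ax; apply: continuousD; [exact: fA | exact: gA].
move=> [df Df] [dg Dg]; split=> [x Ax|v].
  by apply: differentiableD; [exact: df | exact: dg].
apply: (Ck_near_eq _ (IH _ _ (Df v) (Dg v))); apply: open_nearP => // x Ax /=.
by rewrite deriveD//; apply/diff_derivable; [exact: df | exact: dg].
Qed.

Lemma CkM k A f g : open A -> Ck k A f -> Ck k A g -> Ck k A (fun x => f x * g x).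
Proof.
move=> oA; elim: k f g => [|k IH] f g.
  by move=> fA gA x Ax; apply: continuousM; [exact: fA | exact: gA].
move=> fA gA; have [df Df] := fA; have [dg Dg] := gA; split=> [x Ax|v].
  by apply: differentiableM; [exact: df | exact: dg].
(* The Leibniz rule multiplies derivatives by the functions themselves, which must therefore be
   lowered to class [k] first. *)
have fDg := IH _ _ (CkS fA) (Dg v); have gDf := IH _ _ (CkS gA) (Df v).
apply: (Ck_near_eq _ (CkD oA fDg gDf)); apply: open_nearP => // x Ax /=.
by rewrite deriveM//; apply/diff_derivable; [exact: df | exact: dg].
Qed.

Lemma Ck_sum k A (I : Type) (r : seq I) (F : I -> E -> R) : open A ->
  (forall i, Ck k A (F i)) -> Ck k A (fun x => \sum_(i <- r) F i x).
Proof.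
move=> oA FA; elim: r => [|i r IH].
  rewrite (_ : (fun _ => _) = fun=> 0); first exact: Ck_cst.
  by apply/funext => x; rewrite big_nil.
rewrite (_ : (fun _ => _) = fun x => F i x + \sum_(j <- r) F j x).
  exact: CkD.
by apply/funext => x; rewrite big_cons.
Qed.

Lemma rV_sum_delta d (V : Type) (g : V -> 'rV[R]_d) :
  g = \sum_(i < d) (fun x => g x 0 i *: delta_mx 0 i).
Proof.
apply/funext => x; rewrite [LHS]row_sum_delta.
by elim/big_ind2 : _ => // h a h' b -> ->.
Qed.

Lemma differentiable_rV d (g : E -> 'rV[R]_d) x :
  (forall i, differentiable (fun y => g y 0 i) x) -> differentiable g x.
Proof.
move=> dg; rewrite (rV_sum_delta g); apply: differentiable_sum => i.
exact: differentiableZl.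
Qed.

Lemma continuous_rV (T : topologicalType) d (g : T -> 'rV[R]_d) (x : T) :
  (forall i, {for x, continuous (fun y => g y 0 i)}) -> {for x, continuous g}.
Proof.
move=> cg; rewrite (rV_sum_delta g).
elim/big_ind : _ => [|h h' ch ch'|i _]; first exact: cst_continuous.
  exact: continuousD.
by apply: (@continuousZr_tmp _ _ _ (fun y => g y 0 i)); exact: cg.
Qed.

Lemma derive_comp (U V : normedModType R) (F : U -> V) (g : E -> U) (x v : E) :
  differentiable g x -> differentiable F (g x) ->
  'D_v (F \o g) x = 'D_('D_v g x) F (g x).
Proof.
move=> dg dF; rewrite deriveE; last exact: differentiable_comp.
by rewrite diff_comp// (deriveE _ dF) (deriveE _ dg).
Qed.

Lemma pair_sum_delta d (a : R) (w : 'rV[R]_d) :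
  (a, w) = a *: (1, 0) + \sum_(i < d) w 0 i *: (0, delta_mx 0 i) :> R * 'rV[R]_d.
Proof.
have -> : \sum_(i < d) w 0 i *: (0, delta_mx 0 i) = (0, w) :> R * 'rV[R]_d.
  rewrite [w in RHS]row_sum_delta.
  elim/big_ind2 : _ => //= [p q p' q' -> ->|i _].
    by congr pair; rewrite addr0.
  by congr pair; rewrite scaler0.
by congr pair => /=; rewrite ?addr0 ?scaler0 ?add0r//; exact/esym/mulr1.
Qed.

Lemma derive_pair_sum d (f : R * 'rV[R]_d -> R) p (a : R) (w : 'rV[R]_d) :
  differentiable f p ->
  'D_(a, w) f p = a * 'D_(1, 0) f p + \sum_(i < d) w 0 i * 'D_(0, delta_mx 0 i) f p.
Proof.
move=> df; rewrite !(deriveE _ df) pair_sum_delta linearD linearZ linear_sum.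
by congr (_ + _); apply: eq_bigr => i _; rewrite (deriveE _ df) linearZ.
Qed.

(** The chain rule differentiates [f] in a direction that moves with [x], whereas [Ck] speaks of
    fixed directions. Expanding in the basis [(1, 0)], [(0, delta_mx 0 i)] gives a sum of products
    to which the induction hypothesis applies. *)
Lemma Ck_comp_time k d (A : set E) (B : set (R * 'rV[R]_d))
    (f : R * 'rV[R]_d -> R) (g1 : E -> R) (g2 : E -> 'rV[R]_d) :
  open A -> (forall x, A x -> B (g1 x, g2 x)) ->
  Ck k B f -> Ck k A g1 -> (forall i, Ck k A (fun x => g2 x 0 i)) ->
  Ck k A (fun x => f (g1 x, g2 x)).
Proof.
move=> oA AB; elim: k f => [|k IH] f.
  move=> fB g1A g2A x Ax.
  apply: (@continuous_comp _ _ _ (fun x => (g1 x, g2 x)) f); last exact/fB/AB.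
  have g2x : {for x, continuous g2} by apply: continuous_rV => i; exact: g2A.
  by move=> U /=; apply: (cvg_pair (g1A _ Ax) g2x).
move=> fB g1A g2A.
have [df Df] := fB; have [dg1 Dg1] := g1A.
have dg2 x : A x -> differentiable g2 x.
  by move=> Ax; apply: differentiable_rV => i; have [+ _] := g2A i; apply.
have dg x : A x -> differentiable (fun x => (g1 x, g2 x)) x.
  by move=> Ax; apply: differentiable_pair; [exact: dg1 | exact: dg2].
split=> [x Ax|v].
  apply: (@differentiable_comp _ _ _ _ (fun x => (g1 x, g2 x)) f); first exact: dg.
  exact/df/AB.
pose D1 x := 'D_(1, 0) f (g1 x, g2 x) * 'D_v g1 x.
pose D2 i x := 'D_(0, delta_mx 0 i) f (g1 x, g2 x) * 'D_v (fun y => g2 y 0 i) x.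
have D12 : Ck k A (fun x => D1 x + \sum_(i < d) D2 i x).
  have fg w : Ck k A (fun x => 'D_w f (g1 x, g2 x)).
    by apply: (IH ('D_w f)) => [||i]; [exact: Df | exact: CkS | exact: CkS].
  apply: CkD => //; first by apply: CkM => //; exact: Dg1.
  by apply: Ck_sum => // i; apply: CkM => //; have [_] := g2A i; apply.
apply: (Ck_near_eq _ D12); apply: open_nearP => // x Ax.
have dfx := df _ (AB _ Ax).
rewrite -[RHS]/('D_v (f \o (fun x => (g1 x, g2 x))) x) derive_comp//; last exact: dg.
rewrite {1}[in RHS](deriveE _ (dg _ Ax)) diff_pair; [|exact: dg1|exact: dg2].
rewrite derive_pair_sum// /D1 mulrC -(deriveE _ (dg1 _ Ax)); congr (_ + _).
apply: eq_bigr => i _; rewrite /D2 mulrC -(deriveE _ (dg2 _ Ax)).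
by rewrite derive_mx ?mxE//; exact: diff_derivable (dg2 _ Ax).
Qed.

End Calculus.

Lemma open_prod (T U : topologicalType) (A : set T) (B : set U) : open A -> open B ->
  open [set p : T * U | A p.1 /\ B p.2].
Proof.
move=> oA oB; rewrite (_ : [set _ | _] = fst @^-1` A `&` snd @^-1` B)//.
apply: openI; apply: open_comp => // p _; [exact: cvg_fst|exact: cvg_snd].
Qed.

Section Projections.
Variables (R : realType) (U V : normedModType R).

Lemma is_diff_fst (x : U * V) : is_diff x (fst : U * V -> U) fst.
Proof.
have lin_fst : linear (fst : U * V -> U) by [].
pose fstL : {linear (U * V)%type -> U} :=
  HB.pack (fst : U * V -> U) (GRing.isLinear.Build _ _ _ _ _ lin_fst).
have cfst : continuous fstL by move=> p; exact: cvg_fst.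
by apply: DiffDef; [exact: (linear_differentiable x cfst) | exact: (diff_lin x cfst)].
Qed.

Lemma is_diff_snd (x : U * V) : is_diff x (snd : U * V -> V) snd.
Proof.
have lin_snd : linear (snd : U * V -> V) by [].
pose sndL : {linear (U * V)%type -> V} :=
  HB.pack (snd : U * V -> V) (GRing.isLinear.Build _ _ _ _ _ lin_snd).
have csnd : continuous sndL by move=> p; exact: cvg_snd.
by apply: DiffDef; [exact: (linear_differentiable x csnd) | exact: (diff_lin x csnd)].
Qed.

End Projections.

Lemma Ck_fst (R : realType) k (V : normedModType R) (A : set (R * V)) : Ck k A fst.
Proof.
case: k => [|k]; first by move=> x _; exact: cvg_fst.
split=> [x _|v]; first exact: (@ex_diff _ _ _ _ _ _ _ (is_diff_fst x)).
rewrite (_ : 'D_v _ = fun=> v.1); first exact: Ck_cst.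
apply/funext => x; have [dx dv] := is_diff_fst x.
by rewrite deriveE ?dv.
Qed.

Lemma Ck_snd (R : realType) k (U V : normedModType R) (A : set (U * V)) (B : set V)
    (f : V -> R) :
  (forall x, A x -> B x.2) -> Ck k B f -> Ck k A (fun x => f x.2).
Proof.
move=> AB; elim: k f => [|k IH] f fB.
  by move=> x Ax; apply: continuous_comp; [exact: cvg_snd | exact/fB/AB].
(* The difference quotient of [f \o snd] in the direction [v] is, by computation, that of [f] in the
   direction [v.2]. *)
have [df Df] := fB; split=> [x Ax|v]; last exact: (IH _ (Df v.2)).
apply: differentiable_comp; last exact/df/AB.
exact: (@ex_diff _ _ _ _ _ _ _ (is_diff_snd x)).
Qed.

(** * Charts and tangent vectors *)

Section ManifoldTheory.
Variables (R : realType) (d : nat) (Y : smoothManifold R d).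
Implicit Types (c : chart R d Y) (y z : Y) (A U : set Y).

Lemma chart_invK c y : atlas c -> chart_dom c y -> chart_inv c (chart_map c y) = y.
Proof. by move=> /atlas_chart[_ _ + _ _]; exact. Qed.

Lemma nbhs_chart_dom c y : atlas c -> chart_dom c y -> nbhs y (chart_dom c).
Proof. by move=> /atlas_chart[oc _ _ _ _] cy; exact: open_nbhs_nbhs. Qed.

Lemma chart_map_continuous c y : atlas c -> chart_dom c y ->
  {for y, continuous (chart_map c)}.
Proof. by move=> /atlas_chart[_ _ _ + _]; exact. Qed.

Lemma chart_inv_continuous c x : atlas c -> chart_img c x ->
  {for x, continuous (chart_inv c)}.
Proof. by move=> /atlas_chart[_ _ _ _]; exact. Qed.

Lemma chart_imgP c x : atlas c ->
  chart_img c x <-> chart_dom c (chart_inv c x) /\ chart_map c (chart_inv c x) = x.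
Proof.
move=> ac; split=> [[y cy <-]|[cx <-]]; first by rewrite chart_invK.
by exists (chart_inv c x).
Qed.

Lemma chart_imageP c A x : atlas c ->
  (chart_map c @` (chart_dom c `&` A)) x <-> chart_img c x /\ A (chart_inv c x).
Proof.
move=> ac; split=> [[y [cy Ay] <-]|[/(chart_imgP _ ac)[cx xE] Ax]].
  by rewrite chart_invK//; split=> //; exists y.
by exists (chart_inv c x).
Qed.

Lemma open_chart_image c A : atlas c -> open A ->
  open (chart_map c @` (chart_dom c `&` A)).
Proof.
move=> ac oA; rewrite openE => x /chart_imageP[//|cx Ax].
have [_ oimg _ _ _] := atlas_chart ac.
have invA : nbhs x (chart_inv c @^-1` A).
  by apply: chart_inv_continuous => //; exact: open_nbhs_nbhs.
have imgx : nbhs x (chart_img c) by exact: open_nbhs_nbhs.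
by apply: filterS2 imgx invA => z cz Az; exact/chart_imageP.
Qed.

Lemma smooth_on_pointwise A f : (forall y, A y -> smooth_near y f) -> smooth_on A f.
Proof.
move=> fA c ac k; apply/Ck_pointwise => _ [y [cy Ay] <-].
have [U [_ Uy] /(_ c ac k)] := fA y Ay.
by move=> /Ck_pointwise; apply; exists y.
Qed.

Lemma smooth_near_Ck c y (f : Y -> R) k : atlas c -> chart_dom c y ->
  smooth_near y f -> Ck k [set chart_map c y] (f \o chart_inv c).
Proof.
move=> ac cy [U [_ Uy] /(_ c ac k)/Ck_pointwise]; apply.
by exists y.
Qed.

Lemma smooth_near_differentiable c y (f : Y -> R) : atlas c -> chart_dom c y ->
  smooth_near y f -> differentiable (f \o chart_inv c) (chart_map c y).
Proof. by move=> ac cy /(smooth_near_Ck 1 ac cy)[+ _]; exact. Qed.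

Lemma smooth_near_continuous y (f : Y -> R) : smooth_near y f ->
  {for y, continuous f}.
Proof.
move=> sf; have [c ac cy] := atlas_cover y.
have fc : {for chart_map c y, continuous (f \o chart_inv c)}.
  exact: differentiable_continuous (smooth_near_differentiable ac cy sf).
have := continuous_comp (chart_map_continuous ac cy) fc.
rewrite /prop_for /continuous_at /= chart_invK//; apply: cvg_trans; apply: near_eq_cvg.
by apply: filterS (nbhs_chart_dom ac cy) => z cz /=; rewrite chart_invK.
Qed.

Lemma smooth_near_coord c y i : atlas c -> chart_dom c y ->
  smooth_near y (fun z => chart_map c z 0 i).
Proof.
move=> ac cy; have [oc _ _ _ _] := atlas_chart ac.
by exists (chart_dom c) => // c' ac'; exact: (atlas_compatible ac' ac i).
Qed.

Lemma diffeomorphism_smooth_near psi y f : diffeomorphism psi ->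
  smooth_near y (f \o psi) <-> smooth_near (psi y) f.
Proof.
move=> [[_ psiS] [phi [[_ phiS] psiK phiK]]]; split; last exact: psiS.
rewrite -{1}[y]psiK => /phiS; rewrite (_ : (f \o psi) \o phi = f)//.
by apply/funext => z /=; rewrite phiK.
Qed.

(** The Jacobian rule. As an equality of functionals it also covers non-smooth functions: both sides
    vanish on the same ones, because [psi] preserves smoothness of germs in both directions. *)
Lemma pushforward_partial_at (psi : Y -> Y) c c' y w :
  diffeomorphism psi -> atlas c -> chart_dom c y -> atlas c' ->
  chart_dom c' (psi y) ->
  Defs.pushforward psi (partial_at y c w)
  = partial_at (psi y) c'
      ('D_w (fun x => chart_map c' (psi (chart_inv c x))) (chart_map c y)).
Proof.
move=> dpsi ac cy ac' cy'; apply/funext => f; rewrite /Defs.pushforward /partial_at.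
have -> : `[< smooth_near y (f \o psi) >] = `[< smooth_near (psi y) f >].
  by apply/asbool_equiv_eq; exact: diffeomorphism_smooth_near.
case: asboolP => // sf.
have [[cpsi psiS] _] := dpsi.
set g := fun x => chart_map c' (psi (chart_inv c x)); set x := chart_map c y.
have xy : chart_inv c x = y by rewrite /x chart_invK.
have gx : g x = chart_map c' (psi y) by rewrite /g /= xy.
have cx : chart_img c x by exists y.
rewrite -gx -derive_comp; last 2 first.
- apply: differentiable_rV => i.
  apply: (smooth_near_differentiable (f := (fun z => chart_map c' z 0 i) \o psi)) => //.
  by apply: psiS; exact: smooth_near_coord.
- by rewrite gx; exact: smooth_near_differentiable.
apply: near_eq_derive.
have : {for x, continuous (psi \o chart_inv c)}.
  by apply: continuous_comp; [exact: chart_inv_continuous | exact: cpsi].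
rewrite /prop_for /continuous_at /= xy => /(_ _ (nbhs_chart_dom ac' cy')) cz.
have {cz} : \forall z \near x, chart_dom c' (psi (chart_inv c z)) by exact: cz.
by apply: filterS => z cz; rewrite /g /= chart_invK.
Qed.

Lemma diffeomorphism_id : diffeomorphism (@id Y).
Proof. by split; [|exists id; split=> //]; split=> // y; exact: cvg_id. Qed.

Lemma tangent_chart c y v : atlas c -> chart_dom c y -> tangent y v ->
  exists w, v = partial_at y c w.
Proof.
move=> ac cy [c' [w [ac' c'y ->]]].
(* A change of charts is the Jacobian rule for the identity map. *)
by eexists; exact: (pushforward_partial_at w diffeomorphism_id ac' c'y ac cy).
Qed.

Lemma tangent_partial_at c y w : atlas c -> chart_dom c y ->
  tangent y (partial_at y c w).
Proof. by exists c, w. Qed.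

Lemma tangent_pushforward psi y v : diffeomorphism psi -> tangent y v ->
  tangent (psi y) (Defs.pushforward psi v).
Proof.
move=> dpsi [c [w [ac cy ->]]]; have [c' ac' cy'] := atlas_cover (psi y).
rewrite (pushforward_partial_at w dpsi ac cy ac' cy').
exact: tangent_partial_at.
Qed.

Lemma tangent_linear y a v w : tangent y v -> tangent y w ->
  tangent y (fun f => a * v f + w f).
Proof.
have [c ac cy] := atlas_cover y.
move=> /(tangent_chart ac cy)[v' ->] /(tangent_chart ac cy)[w' ->].
exists c, (a *: v' + w'); split=> //; apply/funext => f; rewrite /partial_at.
case: asboolP => [/(smooth_near_differentiable ac cy) df|_]; last by rewrite mulr0 addr0.
by rewrite !(deriveE _ df) linearD linearZ.
Qed.

Lemma tangent_zero y : tangent y (@zero_vector _ _ Y).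
Proof.
have [c ac cy] := atlas_cover y; exists c, 0; split=> //; apply/funext => f.
by rewrite /partial_at derive0; case: ifP.
Qed.

Lemma linear_at_zero y (alpha : one_form Y) : linear_at y alpha ->
  alpha y (@zero_vector _ _ Y) = 0.
Proof.
move=> la; have := la 1 _ _ (tangent_zero y) (tangent_zero y).
rewrite (_ : (fun f => _) = @zero_vector _ _ Y); last first.
  by apply/funext => f; rewrite /zero_vector mulr0 addr0.
by lra.
Qed.

End ManifoldTheory.

(** * Pullback by diffeomorphisms and contactomorphisms *)

Section Pullback.
Variables (R : realType) (d : nat) (Y : smoothManifold R d).

Lemma diffeomorphism_continuous (psi : Y -> Y) : diffeomorphism psi -> continuous psi.
Proof. by move=> [[]]. Qed.

Lemma continuous_time_map (psi : Y -> Y) : continuous psi ->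
  continuous (fun p : R * Y => (p.1, psi p.2)).
Proof.
move=> cpsi p; have c1 : fst @ nbhs p --> p.1 by exact: cvg_fst.
have c2 : psi \o snd @ nbhs p --> psi p.2.
  by apply: continuous_comp; [exact: cvg_snd | exact: cpsi].
exact: (cvg_pair c1 c2).
Qed.

Lemma diffeomorphism_inv (psi phi : Y -> Y) : diffeomorphism psi ->
  cancel psi phi -> cancel phi psi -> diffeomorphism phi.
Proof.
move=> [spsi [phi' [sphi' psiK' phiK']]] psiK phiK.
have -> : phi = phi' by apply/funext => y; rewrite -[in LHS](phiK' y) psiK.
by split=> //; exists psi.
Qed.

(** A single chart [c'] around [psi y] suffices: [U'] is cut down so that [psi] maps it into the
    domain of [c'], where the function is a composite of coordinate expressions. *)
Lemma smooth_near_time_comp (psi : Y -> Y) t y (G : R -> Y -> R) :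
  diffeomorphism psi -> smooth_near_time t (psi y) G ->
  smooth_near_time t y (fun s x => G s (psi x)).
Proof.
move=> dpsi [I [U [[oI It] [oU Uy] sG]]].
have [c' ac' cy'] := atlas_cover (psi y); have [oc' _ _ _ _] := atlas_chart ac'.
have cpsi := diffeomorphism_continuous dpsi.
pose U' := psi @^-1` (chart_dom c' `&` U).
have oU' : open U'.
  by apply: open_comp; [move=> z _; exact: cpsi | exact: openI].
exists I, U'; split=> // c ac k.
set A := [set p | _].
have oA : open A by apply: open_prod => //; exact: open_chart_image.
pose B := [set p : R * 'rV[R]_d |
  I p.1 /\ (chart_map c' @` (chart_dom c' `&` U)) p.2].
pose g (x : 'rV[R]_d) := chart_map c' (psi (chart_inv c x)).
have AU p : A p -> chart_dom c' (psi (chart_inv c p.2)) /\ U (psi (chart_inv c p.2)).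
  by move=> [_ /chart_imageP[]].
have gk i : Ck k (chart_map c @` (chart_dom c `&` U')) (fun x => g x 0 i).
  have : smooth_on U' ((fun z => chart_map c' z 0 i) \o psi).
    apply: smooth_on_pointwise => z [cz _].
    by apply/diffeomorphism_smooth_near => //; exact: smooth_near_coord.
  by move=> /(_ c ac k).
have : Ck k A (fun p => (fun q => G q.1 (chart_inv c' q.2)) (p.1, g p.2)).
  apply: (@Ck_comp_time _ _ k d A B (fun q => G q.1 (chart_inv c' q.2)) fst
    (fun p => g p.2)) => //.
  - by move=> p Ap; have [cz Uz] := AU p Ap; split; [case: Ap|exists (psi (chart_inv c p.2))].
  - exact: sG.
  - exact: Ck_fst.
  - by move=> i; apply: Ck_snd (gk i) => p [].
apply: Ck_near_eq; apply: open_nearP => // p Ap.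
by have [cz _] := AU p Ap; rewrite /= /g chart_invK.
Qed.

(** This is the pullback of [V] by [psi] when [phi] is the inverse of [psi]. *)
Definition pullback_time_field (psi phi : Y -> Y) (V : time_field Y) : time_field Y :=
  fun t y => Defs.pushforward phi (V t (psi y)).

Section Diffeomorphism.
Variables (psi phi : Y -> Y).
Hypotheses (dpsi : diffeomorphism psi) (psiK : cancel psi phi) (phiK : cancel phi psi).

Let dphi : diffeomorphism phi := diffeomorphism_inv dpsi psiK phiK.

Lemma smooth_near_pullback y f : smooth_near y f <-> smooth_near (psi y) (f \o phi).
Proof.
rewrite -(diffeomorphism_smooth_near _ _ dpsi) (_ : (f \o phi) \o psi = f)//.
by apply/funext => z /=; rewrite psiK.
Qed.

Lemma pushforwardK v : Defs.pushforward phi (Defs.pushforward psi v) = v.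
Proof.
apply/funext => f; rewrite /Defs.pushforward; congr v.
by apply/funext => z /=; rewrite psiK.
Qed.

Lemma near_time_pullback (t : R) (y : Y) (P : R * Y -> Prop) :
  (\forall p \near (t, psi y), P p) -> \forall p \near (t, y), P (p.1, psi p.2).
Proof.
by move=> Py; exact: (continuous_time_map (diffeomorphism_continuous dpsi) (x := (t, y)) Py).
Qed.

Lemma smooth_time_field_pullback V : smooth_time_field V ->
  smooth_time_field (pullback_time_field psi phi V).
Proof.
move=> sV t y t01; have [tV dV] := sV t (psi y) t01; split.
  by rewrite /pullback_time_field -[y in tangent y]psiK; exact: tangent_pushforward.
move=> f /smooth_near_pullback/dV[G sG GV].
exists (fun s x => G s (psi x)); first exact: smooth_near_time_comp.
exact: near_time_pullback GV.
Qed.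

(** Testing the conjugate orbit against [f] is testing the original orbit against [f \o phi], so the
    differential equation carries over verbatim. *)
Lemma is_flow_pullback V Phi : is_flow V Phi ->
  is_flow (pullback_time_field psi phi V) (fun t y => phi (Phi t (psi y))).
Proof.
move=> fV y; have [P0 cP dP] := fV (psi y); split; first by rewrite P0 psiK.
- move=> t; apply: continuous_comp; first exact: cP.
  exact: diffeomorphism_continuous.
- move=> t f t01; rewrite -(diffeomorphism_smooth_near _ _ dphi) => /(dP t _ t01).
  by rewrite /pullback_time_field phiK.
Qed.

Lemma pullback_time_field_eq0 V t y :
  (pullback_time_field psi phi V t y = @zero_vector _ _ Y)
  <-> V t (psi y) = @zero_vector _ _ Y.
Proof.
split=> [V0|V0]; last by rewrite /pullback_time_field V0.
apply/funext => f; have : pullback_time_field psi phi V t y (f \o psi) = 0 by rewrite V0.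
rewrite /pullback_time_field /Defs.pushforward => {V0}.
by rewrite (_ : (f \o psi) \o phi = f)//; apply/funext => z /=; rewrite phiK.
Qed.

Lemma time_support_pullback V p :
  time_support (pullback_time_field psi phi V) p -> time_support V (p.1, psi p.2).
Proof.
case: p => t y Vp B /near_time_pullback => /Vp[[s x] [[s01 V0] Bp]].
by exists (s, psi x); split=> //; split=> // V0'; exact/V0/pullback_time_field_eq0.
Qed.

Lemma compact_time_support_pullback V : compact (time_support V) ->
  compact (time_support (pullback_time_field psi phi V)).
Proof.
move=> cV; pose h (p : R * Y) := (p.1, phi p.2).
apply: (@subclosed_compact _ _ (h @` time_support V)).
- exact: closed_closure.
- apply: continuous_compact => //; apply: continuous_subspaceT.
  exact: continuous_time_map (diffeomorphism_continuous dphi).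
- move=> [t y] /time_support_pullback Vp; exists (t, psi y) => //.
  by rewrite /h /= psiK.
Qed.

End Diffeomorphism.
End Pullback.

(** * Invariance of contact fields under contactomorphisms *)

Section ContactPullback.
Variables (R : realType) (n : nat) (Y : contactManifold R n).

Lemma xi_tangent (y : Y) v : xi Y y v -> tangent y v.
Proof.
have [U [alpha [[_ Uy] _ kerU _]]] := xi_contact y.
by rewrite -(kerU _ Uy) => -[].
Qed.

Variables (psi phi : Y -> Y).
Hypotheses (cpsi : contactomorphism psi) (psiK : cancel psi phi) (phiK : cancel phi psi).

Let dpsi : diffeomorphism psi. Proof. by case: cpsi. Qed.
Let dphi : diffeomorphism phi := diffeomorphism_inv dpsi psiK phiK.

Lemma smooth_field_near_pushforward y (X : vector_field Y) : smooth_field_near y X ->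
  smooth_field_near (psi y) (fun z => Defs.pushforward psi (X (phi z))).
Proof.
move=> [U [oU Uy] sX]; exists (phi @^-1` U).
  split; last by rewrite /= psiK.
  by apply: open_comp => // z _; exact: diffeomorphism_continuous dphi _.
move=> z Uz; have [tX dX] := sX _ Uz; split.
  by rewrite -[z in tangent z]phiK; exact: tangent_pushforward.
move=> f sf.
rewrite (_ : (fun x => _) = (fun x => X x (f \o psi)) \o phi)//.
rewrite (diffeomorphism_smooth_near _ _ dphi); apply: dX.
by rewrite (diffeomorphism_smooth_near _ _ dpsi) phiK.
Qed.

(** Naturality of the Lie bracket: both sides unfold to the same expression once [phi] and [psi]
    cancel, and [f] is smooth near [y] exactly when [f \o phi] is smooth near [psi y], so the
    truncations agree. *)
Lemma bracket_pullback (V X : vector_field Y) y :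
  bracket (fun z => Defs.pushforward phi (V (psi z))) X y
  = Defs.pushforward phi
      (bracket V (fun z => Defs.pushforward psi (X (phi z))) (psi y)).
Proof.
apply/funext => f; rewrite /bracket /Defs.pushforward.
rewrite (asbool_equiv_eq (smooth_near_pullback dpsi psiK y f)); case: ifP => // _.
rewrite psiK; congr (V _ _ - _); apply/funext => z /=; congr (X _ _).
by apply/funext => x /=; rewrite psiK.
Qed.

Lemma contact_field_pullback (V : vector_field Y) : contact_field V ->
  contact_field (fun z => Defs.pushforward phi (V (psi z))).
Proof.
move=> cV y X sX xiX.
have xiB : xi Y (psi y) (bracket V (fun z => Defs.pushforward psi (X (phi z))) (psi y)).
  apply: cV; first exact: smooth_field_near_pushforward.
  have : \forall z \near psi y, xi Y (phi z) (X (phi z)).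
    rewrite -[y in \near y, _]psiK in xiX.
    exact: (@diffeomorphism_continuous _ _ _ _ dphi (psi y) _ xiX).
  apply: filterS => z xiz; rewrite -[z in xi Y z]phiK.
  by apply/(cpsi.2 _ _ (xi_tangent xiz)).
rewrite bracket_pullback; apply/cpsi.2.
  by rewrite -[y in tangent y]psiK; apply: tangent_pushforward => //; exact: xi_tangent.
by rewrite (pushforwardK phiK).
Qed.

Lemma contact_time_field_pullback (W W' : set Y) V : contact_time_field W' V ->
  (forall t y, time_support V (t, y) -> W (phi y)) ->
  contact_time_field W (pullback_time_field psi phi V).
Proof.
move=> [sV cV compV suppV] VW; split.
- exact: smooth_time_field_pullback.
- by move=> t t01; exact: contact_field_pullback (cV t t01).
- exact: compact_time_support_pullback.
- move=> [t y] /(time_support_pullback dpsi phiK) Vty.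
  have [/= t01 _] := suppV _ Vty; split=> //=.
  by rewrite -(psiK y); exact: VW Vty.
Qed.

End ContactPullback.

(** * Convergence of inverses *)

Section Topology.
Variable R : realType.

Lemma connected_ball (V : normedModType R) (x : V) (e : R) : connected (ball x e).
Proof.
pose s z := (fun t : R => x + t *: (z - x)) @` `[0, 1].
have sx z : s z x by exists 0; rewrite ?scale0r ?addr0//= in_itv /= lexx ler01.
have sz z : s z z.
  by exists 1; rewrite /= ?in_itv /= ?lexx ?ler01// scale1r subrKC.
have -> : ball x e = \bigcup_(z in ball x e) s z.
  apply/seteqP; split=> [z xz|_ [z xz [t /= t01 <-]]]; first by exists z.
  move: xz t01; rewrite -ball_normE /ball_ /= in_itv /= => xz /andP[t0 t1].
  rewrite opprD addrA subrr sub0r normrN normrZ ger0_norm// distrC.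
  by apply: le_lt_trans xz; rewrite ler_piMl.
apply: bigcup_connected => [|z _]; first by exists x => z _.
apply: connected_continuous_connected; first exact: segment_connected.
apply: continuous_subspaceT => t; apply: cvgD; first exact: cvg_cst.
exact: scalel_continuous.
Qed.

Lemma connected_closed_ball (V : normedModType R) (x : V) (e : R) :
  connected (closed_ball x e).
Proof. exact: connected_closure (@connected_ball _ x e). Qed.

Lemma compact_closed_ball d (x : 'rV[R]_d) (e : R) : 0 < e -> compact (closed_ball x e).
Proof.
move=> e0; apply: bounded_closed_compact; last exact: closed_ball_closed.
exists (`|x| + e); split; first exact: num_real.
move=> M xM z; rewrite closed_ballE// /closed_ball_ /= => xz.
rewrite -(subrK x z) (le_trans (ler_normD _ _))// addrC distrC.
by rewrite (le_trans _ (ltW xM))// lerD2l.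
Qed.

Variables (d : nat) (Y : smoothManifold R d).

(** A small closed ball in a chart is compact and connected, and [chart_inv] carries both properties
    to [Y]. *)
Lemma manifold_compact_connected_nbhs (y : Y) (A : set Y) : nbhs y A ->
  exists K, [/\ nbhs y K, compact K, connected K & K `<=` A].
Proof.
move=> yA; have [c ac cy] := atlas_cover y; set x := chart_map c y.
have [_ oimg _ _ _] := atlas_chart ac.
have cx : chart_img c x by exists y.
have : nbhs x (chart_img c `&` chart_inv c @^-1` A).
  apply: filterI; first exact: open_nbhs_nbhs.
  by apply: chart_inv_continuous => //; rewrite /x chart_invK.
move=> /nbhs_closedballP[e eA].
have cinv : {within closed_ball x e%:num, continuous (chart_inv c)}.
  apply: continuous_in_subspaceT => z /set_mem/eA[cz _].
  exact: chart_inv_continuous.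
exists (chart_inv c @` closed_ball x e%:num); split.
- have : nbhs y (chart_dom c `&` chart_map c @^-1` closed_ball x e%:num).
    apply: filterI; first exact: nbhs_chart_dom.
    by apply: (chart_map_continuous ac cy); apply/nbhs_closedballP; exists e.
  by apply: filterS => z [cz ez]; exists (chart_map c z) => //; rewrite chart_invK.
- by apply: continuous_compact => //; exact: compact_closed_ball.
- by apply: connected_continuous_connected => //; exact: connected_closed_ball.
- by move=> _ [z /eA[]] _ Az <-.
Qed.

(* If [psi m] is close to [psi] on the frontier of a compact neighborhood [B] of
   [phi y], then [phi_ m] maps a small connected neighborhood of [y] to a
   connected set that avoids that frontier, hence lies in [B]. *)
Lemma compact_open_cvg_inverse (psi_ phi_ : nat -> Y -> Y) (psi phi : Y -> Y)
    (K V : set Y) :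
  {compact-open, psi_ @ \oo --> psi} ->
  (forall m, cancel (psi_ m) (phi_ m)) -> (forall m, cancel (phi_ m) (psi_ m)) ->
  (forall m, continuous (phi_ m)) ->
  cancel psi phi -> cancel phi psi -> continuous phi ->
  compact K -> open V -> phi @` K `<=` V ->
  \forall m \near \oo, phi_ m @` K `<=` V.
Proof.
move=> /compact_open_cvgP cvg psi_K phi_K cphi_ psiK phiK cphi cK oV KV.
suff : \forall m \near \oo, K `<=` (fun y => V (phi_ m y)).
  by apply: filterS => m mK _ [y Ky <-]; exact: mK.
(* Compactness of [K] reduces the claim to a neighborhood of one point [y] together with a range of
   large [m]. *)
move: cK => /compact_near_coveringP; apply => y Ky.
have Vy : nbhs (phi y) V by apply: open_nbhs_nbhs; split=> //; apply: KV; exists y.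
have [B [yB cB _ BV]] := manifold_compact_connected_nbhs Vy.
have cB' := compact_closed (@manifold_hausdorff _ _ Y) cB.
have : nbhs y (phi @^-1` B°) by apply: cphi; exact: nbhs_interior.
move=> /manifold_compact_connected_nbhs[C [yC cC kC CB]].
have cC' := compact_closed (@manifold_hausdorff _ _ Y) cC.
(* As [phi] maps [C] into the interior of [B], [psi] sends the compact frontier of [B] off [C];
   hence so does [psi_ m] for large [m]. *)
have ev1 : \forall m \near \oo, psi_ m @` (B `&` ~` B°) `<=` ~` C.
  apply: cvg.
  - by apply: (subclosed_compact _ cB) => [|z []//]; apply: closedI => //;
      exact/open_closedC/open_interior.
  - exact: closed_openC.
  - by move=> _ [z [Bz nBz] <-] /CB; rewrite /= psiK.
have ev2 : \forall m \near \oo, psi_ m @` [set phi y] `<=` C°.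
  apply: cvg; [exact: compact_set1|exact: open_interior|].
  by move=> _ [_ -> <-]; rewrite phiK; exact: nbhs_singleton (nbhs_interior yC).
exists (C, [set m | psi_ m @` (B `&` ~` B°) `<=` ~` C /\ psi_ m @` [set phi y] `<=` C°]).
  by split=> //; exact: filterI ev1 ev2.
move=> [z m] [/= Cz [{}ev1 {}ev2]].
(* This equality makes the part of the image of [C] lying in [B] relatively open and closed; it
   contains [phi y], so it is everything. *)
have CB1 : phi_ m @` C `&` B = phi_ m @` C `&` B°.
  apply/seteqP; split=> w [Cw Bw]; split=> //; last exact: interior_subset.
  apply: contrapT => nBw; case: Cw => u Cu uw.
  by apply: (ev1 u) => //; exists w; [|rewrite -uw phi_K].
apply: BV; apply: interior_subset.
suff /seteqP[_ sub] : phi_ m @` C `&` B° = phi_ m @` C.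
  by have /sub[] : (phi_ m @` C) (phi_ m z) by exists z.
have /(_ (phi_ m @` C `&` B°)) := connected_continuous_connected kC
  (continuous_subspaceT (cphi_ m)); apply.
- exists (phi y); split; last exact: nbhs_singleton (nbhs_interior yB).
  exists (psi_ m (phi y)); last by rewrite psi_K.
  by apply: interior_subset; apply: ev2; exists (phi y).
- by exists B° => //; exact: open_interior.
- by exists B; rewrite ?CB1.
Qed.

End Topology.

(** * Flows *)

Section RealLemmas.
Variable R : realType.
Implicit Types (a b t s : R).

(** The supremum of the times up to which [P] holds is attained by the closedness hypothesis, and
    the openness hypothesis prevents it from being smaller than [b]. *)
Lemma real_induction a b (P : R -> Prop) : P a ->
  (forall t, a <= t < b -> (forall s, a <= s <= t -> P s) ->
     \forall s \near t, t < s <= b -> P s) ->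
  (forall t, a < t <= b -> (forall s, a <= s < t -> P s) -> P t) ->
  forall t, a <= t <= b -> P t.
Proof.
move=> Pa openP closedP.
pose S := [set t | a <= t <= b /\ forall s, a <= s <= t -> P s].
move=> t0 /andP[at0 t0b]; have leab := le_trans at0 t0b.
have Sa : S a by split=> [|s]; [rewrite lexx | rewrite -eq_le => /eqP <-].
have supS : has_sup S by split; [exists a | exists b => t [/andP[]]].
set m := sup S.
have am : a <= m by exact: sup_upper_bound.
have mb : m <= b by apply: ge_sup; [exists a | move=> t [/andP[]]].
have Plt s : a <= s < m -> P s.
  move=> /andP[as_ sm].
  have ms : 0 < m - s by rewrite subr_gt0.
  have [t [_ tP]] := sup_adherent ms supS; rewrite subKr => st.
  by apply: tP; rewrite as_ ltW.
have Pm : P m.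
  move: am; rewrite le_eqVlt => /orP[/eqP <-//|am].
  by apply: closedP => //; rewrite am.
have Ple s : a <= s <= m -> P s.
  by rewrite (le_eqVlt s) andb_orr => /orP[/andP[_ /eqP ->]|/Plt].
suff bm : b <= m by apply: Ple; rewrite at0 (le_trans t0b).
rewrite leNgt; apply/negP => mltb.
have /nbhs_ballP[e /= e0 eP] := openP m ltac:(by rewrite am) Ple.
(* A time beyond [m] but inside the neighborhood given by [openP]; reaching it contradicts the
   choice of [m]. *)
pose u := Num.min b (m + e / 2).
have mu : m < u by rewrite lt_min mltb ltrDl divr_gt0.
have ub : u <= b by rewrite ge_min lexx.
have : S u.
  split; first by rewrite (le_trans am (ltW mu)).
  move=> s /andP[as_ su]; have [sm|ms] := leP s m; first by apply: Ple; rewrite as_.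
  apply: eP; last by rewrite ms (le_trans su).
  rewrite /ball /= ltr0_norm ?subr_lt0// opprB ltrBlDr.
  rewrite (le_lt_trans su)// gt_min; apply/orP; right.
  by rewrite addrC ltrD2r ltr_pdivrMr// ltr_pMr// ltr1n.
by move=> /(sup_upper_bound supS); rewrite leNgt mu.
Qed.

(** Multiplying by the integrating factor [expR (- K * x)] turns the differential inequality into
    monotonicity. Derivatives enter only in the open interval, as [is_flow] supplies them. *)
Lemma gronwall (h dh : R -> R) (K a b : R) : a <= b ->
  {within `[a, b], continuous h} ->
  (forall x, a < x < b -> is_derive x (1 : R) h (dh x) /\ dh x <= K * h x) ->
  h b <= h a * expR (K * (b - a)).
Proof.
move=> leab ch dhK.
pose E x := expR (- K * x).
have dE x : is_derive x (1 : R) E (- K * E x).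
  rewrite mulrC; apply: is_derive1_comp.
  by apply: is_derive_eq; rewrite /GRing.scale /= mulr1.
pose g x := h x * E x.
have : g b <= g a.
  apply: (@ler0_derive1_le_cc _ g a b) => //; rewrite ?in_itv /= ?lexx ?leab//.
  - move=> x; rewrite in_itv /= => /dhK[dhx _].
    by have [] := @is_deriveM _ _ _ _ _ _ _ _ dhx (dE x).
  - move=> x; rewrite in_itv /= => /dhK[dhx hK].
    have [_ dg] := @is_deriveM _ _ _ _ _ _ _ _ dhx (dE x).
    rewrite derive1E dg /GRing.scale /= mulrA -mulrA mulrCA [_ * (_ * E x)]mulrA.
    have E0 : 0 < E x by exact: expR_gt0.
    nra.
  - move=> x; apply: continuousM; first exact: ch.
    apply: (@continuous_subspaceT _ _ `[a, b] E) => z.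
    exact/differentiable_continuous/derivable1_diffP/(@ex_derive _ _ _ _ _ _ _ (dE z)).
rewrite /g /E => gab.
have -> : h a * expR (K * (b - a)) = (h a * expR (- K * a)) * expR (K * b).
  by rewrite -mulrA -expRD; congr (_ * expR _); ring.
have -> : h b = (h b * expR (- K * b)) * expR (K * b).
  by rewrite -mulrA -expRD -mulrDl addNr mul0r expR0 mulr1.
by rewrite ler_wpM2r// expR_ge0.
Qed.

Lemma rV_entry_le d (x : 'rV[R]_d) i : `|x 0 i| <= `|x|.
Proof.
rewrite [leRHS]/Num.Def.normr /= mx_normrE.
exact: (le_bigmax _ (fun ij : 'I_1 * 'I_d => `|x ij.1 ij.2|) (0, i)).
Qed.

Lemma sqr_norm_rV_le d (x : 'rV[R]_d) : `|x| ^+ 2 <= \sum_i x 0 i ^+ 2.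
Proof.
have s0 : 0 <= \sum_i x 0 i ^+ 2 by apply: sumr_ge0 => i _; exact: sqr_ge0.
have [->|x0] := eqVneq x 0; first by rewrite normr0 expr0n /= sumr_ge0// => i _; exact: sqr_ge0.
suff : `|x| <= Num.sqrt (\sum_i x 0 i ^+ 2).
  by move=> le; rewrite -(sqr_sqrtr s0) lerXn2r ?nnegrE ?sqrtr_ge0.
rewrite [leLHS]/Num.Def.normr /= mx_normrE; apply: bigmax_le => [|[j i] _ /=].
  exact: sqrtr_ge0.
rewrite ord1 -sqrtr_sqr ler_wsqrtr// (bigD1 i)//= lerDl.
by apply: sumr_ge0 => k _; exact: sqr_ge0.
Qed.

End RealLemmas.

(** * Lipschitz bounds for a time-dependent field in a chart *)

Section SpatialLipschitz.
Variables (R : realType) (d : nat).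

Lemma is_derive_segment (F : R * 'rV[R]_d -> R) (t : R) (x w : 'rV[R]_d) (u : R) :
  differentiable F (t, x + u *: w) ->
  is_derive u (1 : R) (fun u => F (t, x + u *: w)) ('D_(0, w) F (t, x + u *: w)).
Proof.
move=> dF.
have E : (fun h : R => h^-1 *: (F (t, x + (h *: 1 + u) *: w) - F (t, x + u *: w)))
    = (fun h : R => h^-1 *: (F (h *: (0, w) + (t, x + u *: w)) - F (t, x + u *: w))).
  apply/funext => h; congr (_ *: (F _ - _)); congr pair.
    by rewrite /= scaler0 add0r.
  by rewrite scalerDl addrCA -scalerA scale1r.
have := @diff_derivable _ _ _ _ _ (0, w) dF; rewrite /derivable /= => cF.
by apply: DeriveDef; rewrite /derivable /derive /= E.
Qed.

(** Mean value theorem along the segment. The factor [d] counts the partial derivatives; each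
    coordinate of [x - x'] is bounded by the maximum norm. *)
Lemma spatial_lipschitz (F : R * 'rV[R]_d -> R) (t : R) (x x' : 'rV[R]_d) (M : R) :
  (forall u : R, 0 <= u <= 1 -> differentiable F (t, x' + u *: (x - x')) /\
     forall j, `|'D_(0, delta_mx 0 j) F (t, x' + u *: (x - x'))| <= M) ->
  `|F (t, x) - F (t, x')| <= d%:R * M * `|x - x'|.
Proof.
move=> dF; pose phi (u : R) := F (t, x' + u *: (x - x')).
have dphi (u : R) : 0 <= u <= 1 -> is_derive u (1 : R) phi
    ('D_(0, x - x') F (t, x' + u *: (x - x'))).
  by move=> /dF[dFu _]; exact: is_derive_segment.
have cphi : {within `[0, 1], continuous phi}.
  apply: continuous_in_subspaceT => u; rewrite inE /= in_itv /= => /dphi[du _].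
  exact/differentiable_continuous/derivable1_diffP.
have dphi' (u : R) : u \in `]0, 1[ -> is_derive u (1 : R) phi
    ('D_(0, x - x') F (t, x' + u *: (x - x'))).
  by move=> /subset_itv_oo_cc; rewrite in_itv; exact: dphi.
have [u u01] := MVT_segment ler01 dphi' cphi.
rewrite /phi scale1r scale0r addr0 subrKC subr0 mulr1 => ->.
rewrite in_itv /= in u01; have [dFu Mu] := dF _ u01.
rewrite derive_pair_sum// mul0r add0r (le_trans (ler_norm_sum _ _ _))//.
rewrite -mulrA -[d in d%:R]card_ord -sum1_card natr_sum mulr_suml ler_sum// => j _.
by rewrite mul1r normrM mulrC ler_pM//; exact: rV_entry_le.
Qed.

End SpatialLipschitz.

Section TimeFieldLipschitz.
Variables (R : realType) (d : nat) (Y : smoothManifold R d).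

Lemma ball_segment (V : normedModType R) (z x x' : V) (e u : R) : 0 <= u <= 1 ->
  ball z e x -> ball z e x' -> ball z e (x' + u *: (x - x')).
Proof.
move=> /andP[u0 u1]; rewrite -ball_normE /ball_ /= => zx zx'.
have -> : z - (x' + u *: (x - x')) = u *: (z - x) + (1 - u) *: (z - x').
  rewrite scalerBl scale1r addrCA -scalerBr opprB [z - x + _]addrC subrKA.
  by rewrite opprD addrA -scalerN opprB.
rewrite (le_lt_trans (ler_normD _ _))// !normrZ !ger0_norm ?subr_ge0//.
move: u0; rewrite le_eqVlt => /orP[/eqP <-|u0]; first by rewrite mul0r add0r subr0 mul1r.
have lt1 : u * `|z - x| < u * e by rewrite ltr_pM2l.
have le2 : (1 - u) * `|z - x'| <= (1 - u) * e by rewrite ler_wpM2l ?subr_ge0// ltW.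
by rewrite (lt_le_trans (ltr_leD lt1 le2))// -mulrDl subrKC mul1r.
Qed.

Lemma time_field_lipschitz (V : time_field Y) (c : chart R d Y) (s : R) (z : Y) :
  smooth_time_field V -> 0 <= s <= 1 -> atlas c -> chart_dom c z ->
  exists e L, [/\ 0 < e, 0 <= L, ball (chart_map c z) e `<=` chart_img c &
    forall t x x' i, 0 <= t <= 1 -> `|t - s| < e ->
      ball (chart_map c z) e x -> ball (chart_map c z) e x' ->
      `|V t (chart_inv c x) (fun y => chart_map c y 0 i)
        - V t (chart_inv c x') (fun y => chart_map c y 0 i)| <= L * `|x - x'|].
Proof.
move=> sV s01 ac cz; have [_ oimg _ _ _] := atlas_chart ac.
have cimg : chart_img c (chart_map c z) by exists z.
have /nbhs_ballP[e0 /= e00 e0img] := open_nbhs_nbhs (conj oimg cimg).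
(* One parameter [M] serves as Lipschitz constant and as inverse radius, so the finitely many
   coordinates are settled together by taking [M] large. *)
pose P i M := forall t x x', 0 <= t <= 1 -> `|t - s| < M^-1 ->
      ball (chart_map c z) M^-1 x -> ball (chart_map c z) M^-1 x' ->
      `|V t (chart_inv c x) (fun y => chart_map c y 0 i)
        - V t (chart_inv c x') (fun y => chart_map c y 0 i)| <= M * `|x - x'|.
have PM i : \forall M \near +oo, P i M.
  (* The estimate is made on the extension [G], which is differentiable in a full neighborhood even
     when [s] is [0] or [1]. *)
  have [_ /(_ _ (smooth_near_coord i ac cz))[G sG GV]] := sV s z s01.
  have [I [U [[oI Is] [oU Uz] /(_ c ac 1%N)[dF cDF]]]] := sG.
  set A := [set p | _] in dF cDF.
  set F := (fun p : R * 'rV[R]_d => G p.1 (chart_inv c p.2)) in dF cDF.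
  pose p0 := (s, chart_map c z).
  have Ap0 : A p0 by split=> //; exists z.
  have oA : open A by apply: open_prod => //; exact: open_chart_image.
  pose M0 := \sum_(j < d) (`|'D_(0, delta_mx 0 j) F p0| + 1).
  have nearA : \forall p \near p0, A p by exact: open_nbhs_nbhs.
  have nearG : \forall p \near p0, 0 <= p.1 <= 1 ->
      G p.1 (chart_inv c p.2) = V p.1 (chart_inv c p.2) (fun y => chart_map c y 0 i).
    have c2 : snd @ nbhs p0 --> chart_map c z by exact: cvg_snd.
    have cinv : chart_inv c \o snd @ nbhs p0 --> z.
      rewrite -[z in _ --> z](chart_invK ac cz).
      exact: cvg_comp c2 (chart_inv_continuous ac cimg).
    have c1 : fst @ nbhs p0 --> s by exact: cvg_fst.
    exact: (cvg_pair c1 cinv) GV.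
  have nearM : \forall p \near p0, forall j, `|'D_(0, delta_mx 0 j) F p| <= M0.
    apply: (@filter_forall _ _ (fun j p => `|'D_(0, delta_mx 0 j) F p| <= M0) (nbhs p0)) => j.
    apply: cvgr_norm_le; first exact: cDF Ap0.
    by rewrite /M0 (bigD1 j)//= -addrA ltrDl ltr_pwDl// sumr_ge0// => k _; rewrite addr_ge0.
  have [[B1 B2] [/= /nbhs_ballP[e1 /= e10 eB1] /nbhs_ballP[e2 /= e20 eB2]] eP] :=
    filterI nearA (filterI nearG nearM).
  pose e := Num.min e1 e2.
  have e_gt0 : 0 < e by rewrite lt_min e10.
  exists (Num.max e^-1 (d%:R * M0)); split; first exact: num_real.
  move=> M; rewrite gt_max => /andP[eM dM] t x x' t01 ts zx zx'.
  have Me : M^-1 <= e.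
    by rewrite -[e]invrK lef_pV2 ?posrE ?invr_gt0 ?(lt_trans _ eM) ?invr_gt0// ltW.
  have tP w : ball (chart_map c z) M^-1 w -> (B1 `*` B2) (t, w).
    move: Me; rewrite le_min => /andP[Me1 Me2] zw; split=> /=.
      by apply: eB1; rewrite /ball /= distrC (lt_le_trans ts).
    exact/eB2/(le_ball Me2).
  have [_ [Gx _]] := eP _ (tP _ zx); have [_ [Gx' _]] := eP _ (tP _ zx').
  rewrite -Gx// -Gx'//; apply: (@le_trans _ _ (d%:R * M0 * `|x - x'|)).
    apply: (@spatial_lipschitz _ _ F) => u u01.
    have [Au [_ Mu]] := eP _ (tP _ (ball_segment u01 zx zx')).
    by split; [exact: dF | exact: Mu].
  by rewrite ler_wpM2r// ltW.
have : \forall M \near +oo, [/\ 0 < M, M^-1 <= e0 & forall i, P i M].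
  near=> M; have M0 : 0 < M by near: M; exact: nbhs_pinfty_gt.
  have eM : e0^-1 <= M by near: M; apply: nbhs_pinfty_ge; exact: num_real.
  split=> //; last by near: M; exact: filter_forall.
  by rewrite -[e0]invrK lef_pV2// posrE invr_gt0.
move=> /filter_ex[M [M0 Me PiM]]; exists M^-1, M; split; rewrite ?invr_gt0 ?ltW//.
  by apply: subset_trans e0img; exact: le_ball.
by move=> t x x' i; exact: PiM.
Unshelve. all: by end_near. Qed.

End TimeFieldLipschitz.

(** * Orbits off the support and continuity in the initial point *)

Section Flow.
Variables (R : realType) (d : nat) (Y : smoothManifold R d).
Variables (V : time_field Y) (Phi : R -> Y -> Y).
Hypotheses (sV : smooth_time_field V) (fV : is_flow V Phi).

Lemma flow_near (t : R) y (A : set Y) : 0 <= t <= 1 -> nbhs (Phi t y) A ->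
  \forall s \near t, 0 <= s <= 1 -> A (Phi s y).
Proof.
move=> t01 nA; have [_ cP _] := fV y.
have := cP t A nA; rewrite /nbhs /= -nbhs_subspace_in; last by rewrite /= in_itv.
by rewrite /within /=; apply: filterS => s As s01; apply: As; rewrite /= in_itv.
Qed.

Lemma flow_comp_continuous (f : Y -> R) y (a b : R) : 0 <= a -> b <= 1 ->
  (forall t, a <= t <= b -> smooth_near (Phi t y) f) ->
  {within `[a, b], continuous (fun t => f (Phi t y))}.
Proof.
move=> a0 b1 sf; have [_ cP _] := fV y.
have cPab : {within `[a, b], continuous (Phi ^~ y)}.
  apply: continuous_subspaceW cP => t /=; rewrite !in_itv /= => /andP[at_ tb].
  by rewrite (le_trans a0)//= (le_trans tb).
rewrite continuous_subspace_in => t /set_mem; rewrite /= in_itv /= => tab.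
apply: (@continuous_comp _ _ _ (Phi ^~ y : subspace `[a, b] -> Y) f).
  exact: cPab.
exact/smooth_near_continuous/sf.
Qed.

Lemma flow_const (f : Y -> R) y (a b : R) : 0 <= a -> b <= 1 -> a <= b ->
  (forall t, a <= t <= b -> smooth_near (Phi t y) f /\ V t (Phi t y) f = 0) ->
  f (Phi b y) = f (Phi a y).
Proof.
move=> a0 b1 ab sf; have [_ _ dP] := fV y.
have df t : t \in `]a, b[ -> is_derive t (1 : R) (fun s => f (Phi s y)) 0.
  rewrite in_itv /= => /andP[at_ tb].
  have [|sft <-] := sf t; first by rewrite !ltW.
  by apply: dP => //; rewrite (le_lt_trans a0)//= (lt_le_trans tb).
have cf := flow_comp_continuous a0 b1 (fun t tab => (sf t tab).1).
by have [t _ /eqP] := MVT_segment ab df cf; rewrite mul0r subr_eq0 => /eqP.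
Qed.

Lemma chart_map_inj c (y z : Y) : atlas c -> chart_dom c y -> chart_dom c z ->
  (forall i, chart_map c y 0 i = chart_map c z 0 i) -> y = z.
Proof.
move=> ac cy cz yz; rewrite -(chart_invK ac cy) -(chart_invK ac cz).
by congr chart_inv; apply/rowP.
Qed.

(** While the orbit stays in a chart and off [K], its velocity is zero, so its coordinates are
    constant; this works forward and backward in time. *)
Lemma flow_locally_fixed (K : set Y) : closed K ->
  (forall t y, 0 <= t <= 1 -> ~ K y -> V t y = @zero_vector _ _ Y) ->
  forall (t : R) y, 0 <= t <= 1 -> ~ K (Phi t y) ->
  \forall s \near t, 0 <= s <= 1 -> Phi s y = Phi t y.
Proof.
move=> clK V0 t y t01 nK; have [c ac cz] := atlas_cover (Phi t y).
have nA : nbhs (Phi t y) (chart_dom c `&` ~` K).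
  apply: filterI; first exact: nbhs_chart_dom.
  by apply: open_nbhs_nbhs; split=> //; exact: closed_openC.
have /nbhs_ballP[e /= e0 eA] := flow_near t01 nA.
apply/nbhs_ballP; exists e => //= s ts s01.
have [/= cs nKs] := eA s ts s01.
move: t01 s01 => /andP[t0 t1] /andP[s0 s1]; move: ts; rewrite /ball /= => ts.
have V0' a b r i : a <= r <= b -> 0 <= a -> b <= 1 ->
    `|t - a| < e -> `|t - b| < e ->
    smooth_near (Phi r y) (fun z => chart_map c z 0 i) /\
    V r (Phi r y) (fun z => chart_map c z 0 i) = 0.
  move=> /andP[ar rb] a0 b1 ta tb.
  have r01 : 0 <= r <= 1 by rewrite (le_trans a0)//= (le_trans rb).
  have [|cr nKr] := eA r _ r01.
    move: ta tb; rewrite /ball /= !ltr_distl => /andP[ta1 ta2] /andP[tb1 tb2].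
    by apply/andP; split; lra.
  by split; [exact: smooth_near_coord | rewrite V0].
have t_t : `|t - t| < e by rewrite subrr normr0.
apply: (chart_map_inj ac cs cz) => i.
have [le_ts|/ltW le_st] := leP t s.
  by apply: (flow_const (f := fun z => chart_map c z 0 i)) => // r tr; exact: (V0' t s).
by apply/esym/(flow_const (f := fun z => chart_map c z 0 i)) => // r tr; exact: (V0' s t).
Qed.

(* The times at which the orbit of [y] is at [Phi 1 y] form a clopen subset of
   [[0, 1]], hence include [0]. *)
Lemma flow_end_fixed (K : set Y) : closed K ->
  (forall t y, 0 <= t <= 1 -> ~ K y -> V t y = @zero_vector _ _ Y) ->
  forall y, ~ K (Phi 1 y) -> Phi 1 y = y.
Proof.
move=> clK V0 y nK; set z := Phi 1 y.
have [P0 _ _] := fV y.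
pose B := [set t : R | 0 <= t <= 1 /\ Phi t y = z].
suff : B = `[0, 1]%classic.
  by move=> /seteqP[_ /(_ 0)[|_ <-//]]; rewrite /= in_itv /= lexx ler01.
apply: segment_connected.
- by exists 1; split; rewrite ?lexx ?ler01.
- exists [set t : R | 0 <= t <= 1 -> Phi t y = z]°; first exact: open_interior.
  apply/seteqP; split=> [t [t01 tz]|t [/=]].
    split; rewrite /= ?in_itv//.
    have nKt : ~ K (Phi t y) by rewrite tz.
    by have := flow_locally_fixed clK V0 t01 nKt; rewrite tz.
  by rewrite in_itv /= => t01 /interior_subset tz; split=> //; exact: tz.
- exists (closure B); first exact: closed_closure.
  apply/seteqP; split=> [t Bt|t [/=]].
    by split; [case: Bt; rewrite /= in_itv | exact: subset_closure].
  rewrite in_itv /= => t01 clB; split=> //; apply: contrapT => tz.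
  have : nbhs (Phi t y) (~` [set z]).
    apply: open_nbhs_nbhs; split=> //; apply: closed_openC.
    exact/accessible_closed_set1/hausdorff_accessible/manifold_hausdorff.
  by move=> /(flow_near t01)/clB[s [[s01 sz] /(_ s01)]].
Qed.

(** The squared Euclidean distance in coordinates: unlike the maximum norm of ['rV[R]_d], it can be
    differentiated along orbits. *)
Definition chart_dist2 (c : chart R d Y) (x y : Y) : R :=
  \sum_i (chart_map c x 0 i - chart_map c y 0 i) ^+ 2.

Lemma chart_dist2_ge c x y : `|chart_map c x - chart_map c y| ^+ 2 <= chart_dist2 c x y.
Proof.
rewrite (le_trans (sqr_norm_rV_le _))// le_eqVlt; apply/orP; left; apply/eqP.
by apply: eq_bigr => i _; rewrite !mxE.
Qed.

(** Each squared coordinate difference has derivative at most [2 L] times the squared distance;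
    summing over the [d] coordinates yields the rate [(d%:R * L) *+ 2]. *)
Lemma flow_gronwall (c : chart R d Y) (a b L : R) x y : atlas c -> 0 <= L ->
  0 <= a -> a <= b -> b <= 1 ->
  (forall t, a <= t <= b -> chart_dom c (Phi t x) /\ chart_dom c (Phi t y)) ->
  (forall t i, a <= t <= b ->
    `|V t (Phi t x) (fun z => chart_map c z 0 i)
      - V t (Phi t y) (fun z => chart_map c z 0 i)|
    <= L * `|chart_map c (Phi t x) - chart_map c (Phi t y)|) ->
  chart_dist2 c (Phi b x) (Phi b y)
  <= chart_dist2 c (Phi a x) (Phi a y) * expR ((d%:R * L) *+ 2 * (b - a)).
Proof.
move=> ac L0 a0 ab b1 cxy VL.
pose f i := fun z => chart_map c z 0 i.
pose u i (t : R) := f i (Phi t x) - f i (Phi t y).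
pose du i (t : R) := V t (Phi t x) (f i) - V t (Phi t y) (f i).
pose h t := \sum_i (u i t * u i t).
have hE t : chart_dist2 c (Phi t x) (Phi t y) = h t.
  by apply: eq_bigr => i _; rewrite expr2.
have sf i t : a <= t <= b -> smooth_near (Phi t x) (f i) /\ smooth_near (Phi t y) (f i).
  by move=> /cxy[cx cy]; split; exact: smooth_near_coord.
have cu i : {within `[a, b], continuous (u i)}.
  move=> t; apply: (@continuousB _ _ (subspace `[a, b])).
    by apply: (flow_comp_continuous a0 b1) => r /(sf i)[].
  by apply: (flow_comp_continuous a0 b1) => r /(sf i)[].
pose dh t := \sum_i (u i t * du i t + u i t * du i t).
rewrite !hE; apply: (@gronwall _ h dh) => //.
  rewrite /h => t.
  have -> : (fun t => \sum_i (u i t * u i t)) = \sum_i ((u i) * (u i)).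
    by apply/funext => r; rewrite fct_sumE.
  elim/big_ind : _ => [|g g' cg cg'|i _]; first exact: cst_continuous.
    exact: (@continuousD _ _ (subspace `[a, b])).
  by apply: (@continuousM _ (subspace `[a, b])); exact: cu.
move=> t /andP[at_ tb]; have tab : a <= t <= b by rewrite !ltW.
have t01 : 0 < t < 1 by rewrite (le_lt_trans a0)//= (lt_le_trans tb).
have dui i : is_derive t (1 : R) (u i) (du i t).
  have [_ _ dx] := fV x; have [_ _ dy] := fV y; have [sx sy] := sf i t tab.
  exact: is_deriveB (dx t _ t01 sx) (dy t _ t01 sy).
split.
  have -> : h = \sum_i ((u i) * (u i)) by apply/funext => r; rewrite fct_sumE.
  exact: is_derive_sum.
have uL i : u i t * du i t <= L * `|chart_map c (Phi t x) - chart_map c (Phi t y)| ^+ 2.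
  rewrite (le_trans (ler_norm _))// normrM expr2 mulrCA ler_pM ?VL//.
  by have := rV_entry_le (chart_map c (Phi t x) - chart_map c (Phi t y)) i; rewrite !mxE.
rewrite -hE; apply: (@le_trans _ _ (\sum_(i < d) (L * chart_dist2 c (Phi t x) (Phi t y)) *+ 2)).
  apply: ler_sum => i _; rewrite -mulr2n lerMn2r/= (le_trans (uL i))//.
  by rewrite ler_wpM2l// chart_dist2_ge.
rewrite sumr_const card_ord -[_ *+ d]mulr_natl le_eqVlt; apply/orP; left; apply/eqP.
by ring.
Qed.

Lemma chart_dist2_continuous c w0 w : atlas c -> chart_dom c w ->
  {for w, continuous (chart_dist2 c ^~ w0)}.
Proof.
move=> ac cw; rewrite (_ : chart_dist2 c ^~ w0 = \sum_i (fun w =>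
    (chart_map c w 0 i - chart_map c w0 0 i) ^+ 2)); last first.
  by apply/funext => x; rewrite fct_sumE.
elim/big_ind : _ => [|g g' cg cg'|i _]; first exact: cst_continuous.
  exact: continuousD.
have cd : {for w, continuous (fun w => chart_map c w 0 i - chart_map c w0 0 i)}.
  apply: (@continuousB _ _ _ (fun w => chart_map c w 0 i) (fun=> _)).
    exact/smooth_near_continuous/smooth_near_coord.
  exact: cst_continuous.
exact: (continuousM cd cd).
Qed.

Lemma flow_closed (Q : set Y) (a t : R) x : closed Q -> 0 <= a -> a < t -> t <= 1 ->
  (forall t', a <= t' < t -> Q (Phi t' x)) -> Q (Phi t x).
Proof.
move=> clQ a0 at_ t1 Qx; apply: contrapT => nQ.
have t01 : 0 <= t <= 1 by rewrite (le_trans a0 (ltW at_)).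
have nQt : nbhs (Phi t x) (~` Q).
  by apply: open_nbhs_nbhs; split=> //; exact: closed_openC.
have /nbhs_ballP[e /= e0 eQ] := flow_near t01 nQt.
have e2 : 0 < e / 2 by rewrite divr_gt0.
pose t' := Num.max a (t - e / 2).
have at' : a <= t' by rewrite le_max lexx.
have t't : t' < t by rewrite gt_max at_ ltrBlDr ltrDl.
have t'01 : 0 <= t' <= 1 by rewrite (le_trans a0 at') (le_trans (ltW t't)).
apply: eQ t'01 _; last by apply: Qx; rewrite at'.
rewrite /ball /= gtr0_norm ?subr_gt0// ltrBlDr -ltrBlDl lt_max; apply/orP; right.
by rewrite ltrD2l ltrN2 ltr_pdivrMr// ltr_pMr// ltr1n.
Qed.

(** The window [e] is chosen so that the orbit of [y] stays well inside one chart during it; there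
    Gronwall's inequality carries continuity from time [a] to time [b]. *)
Lemma flow_continuous_step (s : R) y : 0 <= s <= 1 ->
  exists2 e, 0 < e & forall a b, 0 <= a -> a <= b -> b <= 1 ->
    `|a - s| < e -> `|b - s| < e ->
    {for y, continuous (Phi a)} -> {for y, continuous (Phi b)}.
Proof.
move=> s01; set z := Phi s y; have [c ac cz] := atlas_cover z.
have [r [L [r0 L0 rimg VL]]] := time_field_lipschitz sV s01 ac cz.
pose D (q : R) := [set w | chart_dom c w /\ ball (chart_map c z) q (chart_map c w)].
have nD q w : 0 < q -> D q w -> nbhs w (D q).
  move=> q0 [cw zw]; apply: filterI; first exact: nbhs_chart_dom.
  by apply: (chart_map_continuous ac cw); apply: open_nbhs_nbhs; split=> //; exact: ball_open.
have r2 : 0 < r / 2 by rewrite divr_gt0.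
have /nbhs_ballP[e1 /= e10 e1P] : nbhs s (fun t => 0 <= t <= 1 -> D (r / 2) (Phi t y)).
  by apply: flow_near => //; apply: nD => //; split=> //; exact: ballxx.
exists (Num.min r e1); first by rewrite lt_min r0.
move=> a b a0 ab b1; rewrite !lt_min => /andP[ar ae] /andP[br be] ca A nA.
have window t : a <= t <= b -> [/\ 0 <= t <= 1, `|t - s| < r & `|t - s| < e1].
  move=> /andP[at_ tb]; split; first by rewrite (le_trans a0)//= (le_trans tb).
    by move: ar br; rewrite !ltr_distl => /andP[? ?] /andP[? ?]; apply/andP; split; lra.
  by move: ae be; rewrite !ltr_distl => /andP[? ?] /andP[? ?]; apply/andP; split; lra.
have Dy t : a <= t <= b -> D (r / 2) (Phi t y).
  by move=> /window[t01 _ te]; apply: e1P => //; rewrite /ball /= distrC.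
have [cb zb] : D (r / 2) (Phi b y) by apply: Dy; rewrite ab lexx.
have : nbhs (chart_map c (Phi b y)) (chart_inv c @^-1` A).
  apply: chart_inv_continuous => //; first by exists (Phi b y).
  by rewrite chart_invK.
move=> /nbhs_ballP[e0 /= e00 e0A].
(* An orbit within [r / 4] of that of [y], which stays within [r / 2] of the center, remains within
   [3 r / 4]; the bound [e0] makes it end in [A]. *)
pose e := Num.min e0 (r / 4).
have e_gt0 : 0 < e by rewrite lt_min e00 divr_gt0.
pose K := (d%:R * L) *+ 2.
have K0 : 0 <= K by rewrite mulrn_wge0// mulr_ge0.
(* Time spans are at most [1], so a squared distance below [del] at time [a] grows by a factor at
   most [expR K] and stays below [e ^+ 2]. *)
pose del := e ^+ 2 / expR K.
have del0 : 0 < del by rewrite divr_gt0 ?expR_gt0 ?exprn_gt0.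
pose Da := [set w | chart_dom c w /\ chart_dist2 c w (Phi a y) < del].
have nDa : nbhs (Phi a y) Da.
  have [ca' _] : D (r / 2) (Phi a y) by apply: Dy; rewrite lexx.
  apply: filterI; first exact: nbhs_chart_dom.
  apply: (cvgr_lt _ (chart_dist2_continuous (w0 := Phi a y) ac ca')).
  by rewrite /chart_dist2 big1// => i _; rewrite subrr expr0n.
have nx : \forall x \near y, Da (Phi a x) by exact: ca.
suff : \forall x \near y, A (Phi b x) by [].
apply: filterS nx => x [cx xdel].
have close t : a <= t <= b -> (forall t', a <= t' <= t -> D r (Phi t' x)) ->
    `|chart_map c (Phi t x) - chart_map c (Phi t y)| < e.
  move=> /andP[at_ tb] Dx; rewrite -(@ltr_pXn2r _ 2)// ?nnegrE ?(ltW e_gt0)//.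
  apply: le_lt_trans (chart_dist2_ge _ _ _) _.
  have tt1 : t <= 1 by exact: le_trans b1.
  apply: (@le_lt_trans _ _ (chart_dist2 c (Phi a x) (Phi a y) * expR (K * (t - a)))).
    apply: flow_gronwall => // t'.
      by move=> t't; have [? _] := Dx t' t't; split=> //; have [] := Dy t' ltac:(lra).
    move=> i t't; have [? ?] := Dx t' t't; have [? ?] := Dy t' ltac:(lra).
    have [t'01 t'r _] := window t' ltac:(lra).
    have := VL t' (chart_map c (Phi t' x)) (chart_map c (Phi t' y)) i t'01 t'r.
    rewrite !chart_invK//; apply=> //; apply: le_ball; last by eassumption.
    lra.
  rewrite -(divfK (lt0r_neq0 (expR_gt0 K)) (e ^+ 2)) -/del.
  have Kta : expR (K * (t - a)) <= expR K.
    by rewrite ler_expR ler_piMr// lerBlDr (le_trans tt1)// lerDl.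
  apply: (@le_lt_trans _ _ (chart_dist2 c (Phi a x) (Phi a y) * expR K)); last first.
    by rewrite ltr_pM2r// expR_gt0.
  by rewrite ler_wpM2l//; apply: sumr_ge0 => i _; exact: sqr_ge0.
have near_ball t : a <= t <= b ->
    `|chart_map c (Phi t x) - chart_map c (Phi t y)| < e ->
    ball (chart_map c z) (r / 2 + r / 4) (chart_map c (Phi t x)).
  move=> /Dy[_]; rewrite -ball_normE /ball_ /= => zy; rewrite distrC => yx.
  rewrite -(subrKA (chart_map c (Phi t y))) (le_lt_trans (ler_normD _ _))// ltrD//.
  by rewrite (lt_le_trans yx)// ge_min lexx orbT.
have r34 : r / 2 + r / 4 < r by lra.
(* Gronwall's inequality requires the orbit of [x] to stay in the chart, and its staying there
   follows from the inequality; real induction on time resolves the circularity. *)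
have Dx : forall t, a <= t <= b -> D r (Phi t x).
  apply: real_induction.
  - split=> //; apply: (le_ball (ltW r34)); apply: near_ball; first by rewrite lexx.
    rewrite -(@ltr_pXn2r _ 2)// ?nnegrE ?(ltW e_gt0)//; apply: le_lt_trans (chart_dist2_ge _ _ _) _.
    apply: (lt_le_trans xdel).
    rewrite ler_pdivrMr ?expR_gt0//; apply: ler_peMr; first exact/exprn_ge0/ltW.
    by rewrite -[leLHS]expR0 ler_expR.
  - move=> t /andP[at_ tb] /(_ t ltac:(by rewrite at_ lexx)) Dt.
    have t01 : 0 <= t <= 1 by have [] := window t ltac:(by rewrite at_ ltW).
    apply: filterS (flow_near t01 (nD _ _ r0 Dt)) => t' Dt' /andP[tt' t'b].
    by apply: Dt'; have [] := window t' ltac:(by rewrite t'b (le_trans at_ (ltW tt'))).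
  - move=> t /andP[at_ tb] Dt.
    (* The chart domain need not be closed in [Y], but [Q] is, being compact; so the orbit cannot
       leave the chart at a limit time. *)
    pose Q := chart_inv c @` closed_ball (chart_map c z) (r / 2 + r / 4).
    have Qimg : closed_ball (chart_map c z) (r / 2 + r / 4)
        `<=` ball (chart_map c z) r.
      by apply: closed_ball_subset => //; lra.
    have : Q (Phi t x).
      apply: (@flow_closed _ a); rewrite ?(le_trans tb)//.
        apply: (compact_closed (@manifold_hausdorff _ _ Y)).
        apply: continuous_compact; last by apply: compact_closed_ball; lra.
        apply: continuous_in_subspaceT => w /set_mem/Qimg/rimg.
        exact: chart_inv_continuous.
      move=> t' /andP[at' t't]; have t'ab : a <= t' <= b by rewrite at' (le_trans (ltW t't)).
      have [cx' _] := Dt t' ltac:(by rewrite at').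
      exists (chart_map c (Phi t' x)); last by rewrite chart_invK.
      apply/subset_closed_ball/near_ball => //; apply: close => // t'' /andP[at'' t''t'].
      by apply: Dt; rewrite at'' (le_lt_trans t''t').
    move=> [w /Qimg zw <-]; have /(chart_imgP _ ac)[cw wE] := rimg _ zw.
    by split=> //; rewrite wE.
have bab : a <= b <= b by rewrite ab lexx.
have [cbx _] := Dx b bab.
rewrite -(chart_invK ac cbx); apply: e0A.
rewrite -ball_normE /ball_ /= distrC (lt_le_trans (close b bab Dx))//.
by rewrite ge_min lexx.
Qed.

(** Real induction on [t], starting from the identity at time [0]. The window around [t] is used
    both to move past [t] and to reach [t] from an earlier time. *)
Lemma flow_continuous (t : R) : 0 <= t <= 1 -> continuous (Phi t).
Proof.
move=> t01 y; move: t t01; apply: real_induction.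
- rewrite (_ : Phi 0 = id); first exact: cvg_id.
  by apply/funext => x; have [] := fV x.
- move=> t /andP[t0 t1] cP; have t01 : 0 <= t <= 1 by rewrite t0 ltW.
  have [e e0 step] := flow_continuous_step y t01.
  apply/nbhs_ballP; exists e => // s; rewrite /ball /= distrC => st /andP[ts s1].
  apply: (step t s) => //; rewrite ?subrr ?normr0 ?ltW//.
  by apply: cP; rewrite t0 lexx.
- move=> t /andP[t0 t1] cP; have t01 : 0 <= t <= 1 by rewrite ltW.
  have [e e0 step] := flow_continuous_step y t01.
  pose a := Num.max 0 (t - e / 2).
  have e2 : 0 < e / 2 by rewrite divr_gt0.
  have at_ : a < t by rewrite gt_max t0 ltrBlDr ltrDl.
  have a0 : 0 <= a by rewrite le_max lexx.
  apply: (step a t) => //; rewrite ?subrr ?normr0 ?ltW//; last by apply: cP; rewrite a0.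
  rewrite ltr0_norm ?subr_lt0// opprB ltrBlDr -ltrBlDl lt_max; apply/orP; right.
  by rewrite ltrD2l ltrN2 ltr_pdivrMr// ltr_pMr// ltr1n.
Qed.

End Flow.

(** * Energy *)

Section Energy.
Local Open Scope ereal_scope.

Lemma mul_ereal_sup_le (R : realType) (k : R) (S : set (\bar R)) (b : \bar R) :
  (0 < k)%R -> (forall x, S x -> k%:E * x <= b) -> k%:E * ereal_sup S <= b.
Proof.
move=> k0 Sb; rewrite -lee_pdivlMl//; apply: ge_ereal_sup => x Sx.
by rewrite lee_pdivlMl//; exact: Sb.
Qed.

Import HBNNSimple.

(** No measurability is assumed, so none has to be shown for the energy integrand: the integral is a
    supremum over simple functions, and [k] times one below [f] is one below [g]. *)
Lemma ge0_scale_le_integral d (T : measurableType d) (R : realType)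
    (mu : {measure set T -> \bar R}) (D : set T) (f g : T -> \bar R) (k : R) :
  (0 < k)%R -> (forall x, D x -> 0 <= f x) -> (forall x, D x -> k%:E * f x <= g x) ->
  k%:E * (\int[mu]_(x in D) f x) <= \int[mu]_(x in D) g x.
Proof.
move=> k0 f0 fg.
have g0 x : D x -> 0 <= g x.
  by move=> Dx; apply: le_trans (fg x Dx); rewrite mule_ge0 ?lee_fin ?(ltW k0)//; exact: f0.
rewrite !ge0_integralE//; apply: mul_ereal_sup_le => // _ [h hf <-].
apply: ereal_sup_ubound; exists (scale_nnsfun h (ltW k0)); last exact: sintegralrM.
move=> x /=; rewrite EFinM; have := hf x; rewrite /patch; case: ifPn => [xD hfx|_ hx].
  apply: le_trans (fg x (set_mem xD)).
  by rewrite lee_pmul2l// lte_fin.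
by rewrite mule_ge0_le0 ?lee_fin ?(ltW k0).
Qed.

End Energy.

(** * Comparison of two contact forms on a compact set *)

Section Comparison.
Variables (R : realType) (n : nat) (Y : contactManifold R n).
Implicit Types (alpha : one_form Y) (W K : set Y).

Lemma contact_form_onS W W' alpha : W' `<=` W -> contact_form_on W alpha ->
  contact_form_on W' alpha.
Proof.
by move=> W'W [sA [nA kA]]; split=> [y /W'W/sA//|]; split=> y /W'W; [exact: nA|exact: kA].
Qed.

(* A summand of the nonzero number [wedge_top alpha X y] has a nonzero factor
   [alpha y (X i y)]. *)
Lemma exists_transverse_field (y : Y) :
  exists X, [/\ smooth_field_near y X, tangent y (X y) & ~ xi Y y (X y)].
Proof.
have [U [alpha [[oU Uy] _ kerU /(_ _ Uy)[X sX]]]] := xi_contact y.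
have tX i : tangent y (X i y) by have [B [_ By] /(_ _ By)[]] := sX i.
move=> wX; apply: contrapT => nX; move: wX; rewrite /wedge_top big1 ?eqxx// => s _.
suff -> : alpha y (X (s ord0) y) = 0 by rewrite mul0r mulr0.
apply: contrapT => aX; apply: nX; exists (X (s ord0)); split=> //.
by rewrite -kerU// => -[].
Qed.

Lemma contact_form_neq0 W alpha (y : Y) v : contact_form_on W alpha -> W y ->
  tangent y v -> ~ xi Y y v -> alpha y v != 0.
Proof.
move=> [_ [_ kerW]] Wy tv nv; apply/eqP => av0; apply: nv.
by rewrite -kerW.
Qed.

Lemma contact_form_smooth_continuous W alpha (y : Y) (X : vector_field Y) :
  contact_form_on W alpha -> W y -> smooth_field_near y X ->
  {for y, continuous (fun z => alpha z (X z))}.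
Proof. by move=> [/(_ y) + _] Wy sX => /(_ Wy)[_ /(_ X sX)/smooth_near_continuous]. Qed.

(** Subtracting from [v] the multiple of [x] with the same value of [alpha] gives a vector in [xi],
    which [alpha0] kills as well. *)
Lemma contact_form_ratio W alpha alpha0 (y : Y) x v :
  contact_form_on W alpha -> contact_form_on W alpha0 -> W y ->
  tangent y x -> tangent y v -> alpha y x != 0 ->
  alpha0 y v = alpha y v / alpha y x * alpha0 y x.
Proof.
move=> cA cA0 Wy tx tv ax.
have [[sA [_ kA]] [sA0 [_ kA0]]] := (cA, cA0).
pose a := - (alpha y v / alpha y x).
have : xi Y y (fun f => a * x f + v f).
  rewrite -kA//; split; first exact: tangent_linear.
  by have [-> //] := sA y Wy; rewrite /a mulNr divfK// addNr.
rewrite -kA0// => -[_]; have [-> // _] := sA0 y Wy.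
by rewrite /a mulNr => /eqP; rewrite addrC subr_eq0 => /eqP.
Qed.

(** Along a local field [X] transverse to [xi], the quotient of the two forms is
    [alpha0 (X) / alpha (X)], which is locally bounded; compactness of [K] makes the bound
    uniform. *)
Lemma contact_forms_comparable W alpha alpha0 K : open W ->
  contact_form_on W alpha -> contact_form_on W alpha0 -> compact K -> K `<=` W ->
  exists2 C : R, 0 < C & forall y v, K y -> tangent y v ->
    `|alpha0 y v| <= C * `|alpha y v|.
Proof.
move=> oW cA cA0 cK KW.
have : \forall C \near +oo,
    K `<=` (fun y => forall v, tangent y v -> `|alpha0 y v| <= C * `|alpha y v|).
  move: cK => /compact_near_coveringP; apply => y /KW Wy.
  have [X [sX tX nX]] := exists_transverse_field y.
  have aX := contact_form_neq0 cA Wy tX nX.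
  have cX := contact_form_smooth_continuous cA Wy sX.
  have cX0 := contact_form_smooth_continuous cA0 Wy sX.
  pose q := `|alpha y (X y)| / 2; pose M := `|alpha0 y (X y)| + 1.
  have q0 : 0 < q by rewrite divr_gt0// normr_gt0.
  have nq : \forall z \near y, q < `|alpha z (X z)|.
    apply: cvgr_norm_gt cX _ _; rewrite /q ltr_pdivrMr// ltr_pMr ?normr_gt0//.
    by rewrite ltr1n.
  have nM : \forall z \near y, `|alpha0 z (X z)| <= M.
    by apply: cvgr_norm_le cX0 _ _; rewrite ltrDl.
  have nW : nbhs y W by exact: open_nbhs_nbhs.
  have nT : \forall z \near y, tangent z (X z).
    have [B [oB By] BX] := sX.
    by apply: filterS (open_nbhs_nbhs (conj oB By)) => z /BX[].
  exists ([set z | (q < `|alpha z (X z)| /\ `|alpha0 z (X z)| <= M) /\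
                   (W z /\ tangent z (X z))], [set C | M / q < C]).
    split=> /=; last by exists (M / q); split=> //; exact: num_real.
    exact: filterI (filterI nq nM) (filterI nW nT).
  move=> [z C] [/= [[qz Mz] [Wz Tz]] MC] v tv.
  have az : alpha z (X z) != 0 by rewrite -normr_gt0 (lt_trans q0).
  rewrite (contact_form_ratio cA cA0 Wz Tz tv az) normrM normf_div.
  rewrite [leRHS]mulrC -mulrA ler_wpM2l// (le_trans _ (ltW MC))// mulrC.
  have az0 : 0 < `|alpha z (X z)| by exact: lt_trans qz.
  by apply: ler_pM; rewrite ?invr_ge0// lef_pV2 ?posrE// ltW.
move=> near_C.
have [C [C0 CK]] : exists C : R, 0 < C /\
    K `<=` (fun y => forall v, tangent y v -> `|alpha0 y v| <= C * `|alpha y v|).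
  by apply: (@filter_ex _ (pinfty_nbhs R)); apply: filterI => //; exact: nbhs_pinfty_gt.
by exists C => // y v Ky; exact: CK.
Qed.

(** Being smooth on a set [G] that contains the closure of [W], [alpha] is its own continuous
    extension. *)
Lemma contact_form_rigidity W G alpha : contact_form_on G alpha -> closure W `<=` G ->
  rigidity_form W alpha.
Proof.
move=> cA WG; have [sA repA] := cA.
have [_ [nW kW]] := contact_form_onS WG cA.
split; first by apply: contact_form_onS cA; apply: subset_trans WG; exact: subset_closure.
exists alpha; split=> // y /WG Gy; have [lA _] := sA y Gy; split=> // X sX.
have cX := contact_form_smooth_continuous cA Gy sX.
exact: cvg_within_filter cX.
Qed.

End Comparison.

(** * Conjugated isotopies and their energy *)

Section LocalRigidity.
Variables (R : realType) (n : nat) (Y : contactManifold R n).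

Lemma contactomorphism_inv (psi : Y -> Y) : contactomorphism psi ->
  exists phi, [/\ continuous phi, cancel psi phi & cancel phi psi].
Proof. by move=> [[_ [phi [[cphi _] psiK phiK]]] _]; exists phi. Qed.

Lemma time_fieldS (W W' : set Y) V : W `<=` W' -> contact_time_field W V ->
  contact_time_field W' V.
Proof. by move=> WW' [sV cV kV WV]; split=> // p /WV[p01 /WW']. Qed.

Lemma time_field_eq0 (W : set Y) V t y : contact_time_field W V -> 0 <= t <= 1 ->
  ~ W y -> V t y = @zero_vector _ _ Y.
Proof.
move=> [_ _ _ WV] t01 nW; apply: contrapT => V0; apply: nW.
by have [] := WV (t, y) (subset_closure (conj t01 V0)).
Qed.

(* Pointwise, [|alpha0 (psi^* V)| <= C |alpha (psi^* V)| = C |alpha' V| / |f|]. *)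
Lemma pullback_sup_le (psi phi : Y -> Y) (W W1 W' : set Y) V
    (alpha0 alpha alpha' : one_form Y) (f : Y -> R) (C delta t : R) (y0 : Y) :
  contactomorphism psi -> cancel psi phi -> cancel phi psi ->
  contact_time_field W' V ->
  contact_time_field W1 (pullback_time_field psi phi V) ->
  0 < C -> 0 < delta -> 0 <= t <= 1 -> W' y0 ->
  (forall y, W y -> linear_at y alpha0) ->
  (forall y v, W1 y -> tangent y v -> `|alpha0 y v| <= C * `|alpha y v|) ->
  (forall y, W1 y -> delta <= `|f y|) ->
  (forall y v, W1 y -> tangent y v ->
     alpha' (psi y) (Defs.pushforward psi v) = f y * alpha y v) ->
  ((delta / C)%:E *
    ereal_sup [set (`|alpha0 y (pullback_time_field psi phi V t y)|)%:E | y in W]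
   <= ereal_sup [set (`|alpha' y (V t y)|)%:E | y in W'])%E.
Proof.
move=> cpsi psiK phiK cV cV1 C0 delta0 t01 W'y0 lin0 le_C le_f pull.
apply: mul_ereal_sup_le; first exact: divr_gt0.
move=> _ [y Wy <-]; set v := pullback_time_field psi phi V t y.
(* Where the pulled-back field vanishes, as it does on [W] outside [W1], only nonnegativity of the
   right-hand supremum is at stake; [y0] witnesses it. *)
have [v0|v0] := pselect (v = @zero_vector _ _ Y).
  rewrite v0 (linear_at_zero (lin0 y Wy)) normr0 mule0.
  apply: le_trans (ereal_sup_ubound _); last by exists y0.
  by rewrite lee_fin.
have W1y : W1 y.
  by apply: contrapT => nW1; apply: v0; exact: time_field_eq0 cV1 t01 nW1.
have W'y : W' (psi y).
  apply: contrapT => nW'; apply: v0; apply/(pullback_time_field_eq0 phiK).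
  exact: time_field_eq0 cV t01 nW'.
have tv : tangent y v by case: cV1 => sV1 _ _ _; have [] := sV1 t y t01.
have pushv : Defs.pushforward psi v = V t (psi y) by exact: (pushforwardK phiK).
apply: le_trans (ereal_sup_ubound _); last by exists (psi y).
rewrite -EFinM lee_fin -pushv pull// normrM.
apply: (@le_trans _ _ (delta / C * (C * `|alpha y v|))).
  by rewrite ler_wpM2l ?le_C// ltW// divr_gt0.
by rewrite mulrA divfK ?gt_eqF// ler_wpM2r// le_f.
Qed.

(** A point that ends in the spatial support [S] is in [W]; one that ends off [S] has not moved, so
    it is still in [K]. *)
Lemma flow_compact_image (W K : set Y) V Phi : contact_time_field W V -> is_flow V Phi ->
  compact K -> K `<=` W -> compact (Phi 1 @` K) /\ Phi 1 @` K `<=` W.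
Proof.
move=> cV fV cK KW; have [sV _ kV WV] := cV; split.
  apply: continuous_compact => //; apply: continuous_subspaceT.
  by apply: (flow_continuous sV fV); rewrite ler01 lexx.
pose S := snd @` time_support V.
have cS : compact S.
  by apply: continuous_compact => //; apply: continuous_subspaceT => p; exact: cvg_snd.
have clS := compact_closed (@manifold_hausdorff _ _ Y) cS.
move=> _ [y Ky <-]; have [[[t z] Vtz /= <-]|nS] := pselect (S (Phi 1 y)).
  by have [] := WV _ Vtz.
rewrite (flow_end_fixed fV clS _ nS); first exact: KW.
move=> t z t01 nSz; apply: contrapT => V0; apply: nSz.
by exists (t, z) => //; exact: subset_closure.
Qed.

End LocalRigidity.

Section EnergyComparison.
Variables (R : realType) (n : nat) (Y : contactManifold R n).
Variables (psi_ phi_ : nat -> Y -> Y) (psi phi : Y -> Y).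
Hypotheses (cpsi_ : forall m, contactomorphism (psi_ m))
  (psi_K : forall m, cancel (psi_ m) (phi_ m))
  (phi_K : forall m, cancel (phi_ m) (psi_ m))
  (cphi_ : forall m, continuous (phi_ m))
  (psi_cvg : C0_cvg psi_ psi)
  (psiK : cancel psi phi) (phiK : cancel phi psi) (cphi : continuous phi).

(* Any isotopy disjoining [U'] from [psi @` N] is conjugated by [psi_ m], for
   [m] large, to one disjoining [U] from [N]. *)
Lemma disjunction_energy_le (W W1 U U' N : set Y) (p : Y)
    (alpha0 alpha alpha' : one_form Y) (f_ : nat -> Y -> R) (C delta : R) :
  open W1 -> W1 `<=` W -> W1 p -> closed_in W (N `&` W) ->
  compact (closure U) -> open U' -> psi @` closure U `<=` U' ->
  compact (closure U') -> closure U' `<=` psi @` W1 ->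
  0 < C -> 0 < delta ->
  (forall y, W y -> linear_at y alpha0) ->
  (forall y v, W1 y -> tangent y v -> `|alpha0 y v| <= C * `|alpha y v|) ->
  (forall m y, W1 y -> delta <= `|f_ m y|) ->
  (forall m y v, W1 y -> tangent y v ->
     alpha' (psi_ m y) (Defs.pushforward (psi_ m) v) = f_ m y * alpha y v) ->
  ((delta / C)%:E * disjunction_energy W alpha0 U N
   <= disjunction_energy (psi @` W1) alpha' U' (psi @` N))%E.
Proof.
move=> oW1 W1W W1p [F clF NF] cU oU' psiU cU' U'W1 C0 delta0 lin0 le_C le_f pull.
have phiW1 : phi @` (psi @` W1) `<=` W1 by move=> _ [_ [y W1y <-] <-]; rewrite psiK.
apply: le_ereal_inf_tmp => _ [V [Phi [cV fV dis ->]]].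
have [_ _ kV WV] := cV.
pose S := snd @` time_support V.
have cS : compact S.
  by apply: continuous_compact => //; apply: continuous_subspaceT => x; exact: cvg_snd.
have SW1 : phi @` S `<=` W1.
  by move=> _ [_ [x /WV[_ Wx] <-] <-]; apply: phiW1; exists x.2.
have [cP PW1] := flow_compact_image cV fV cU' U'W1.
(* [N] itself need not be closed, but inside [W1] it coincides with the closed set [F]; so this is
   an open target avoiding [N]. *)
have oW1F : open (W1 `&` ~` F) by apply: openI => //; exact: closed_openC.
have PF : phi @` (Phi 1 @` closure U') `<=` W1 `&` ~` F.
  move=> _ [y Py <-]; have W1y : W1 (phi y).
    by apply: phiW1; exists y => //; exact: PW1.
  split=> // Fy; have : (Phi 1 @` closure U' `&` psi @` N) y.
    split=> //; exists (phi y) => //.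
    by have [] : (N `&` W) (phi y) by rewrite NF; split=> //; exact: W1W.
  by rewrite dis.
have near_inv K A := @compact_open_cvg_inverse _ _ _ psi_ phi_ psi phi K A
  psi_cvg psi_K phi_K cphi_ psiK phiK cphi.
have ev3 : \forall m \near \oo, psi_ m @` closure U `<=` U'.
  by move/compact_open_cvgP: psi_cvg; apply.
(* The index [m] may depend on [V], because the factor [delta / C] does not depend on [m]. *)
have [m [SW1m [PFm Um]]] := filter_ex (filterI (near_inv _ _ cS oW1 SW1)
  (filterI (near_inv _ _ cP oW1F PF) ev3)).
have cV1 : contact_time_field W1 (pullback_time_field (psi_ m) (phi_ m) V).
  apply: contact_time_field_pullback cV _ => // t y Vty.
  by apply: SW1m; exists y => //; exists (t, y).
have [dpsi_ _] := cpsi_ m.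
pose I := (\int[lebesgue_measure]_(t in `[0%R, 1%R])
  ereal_sup [set (`|alpha0 y (pullback_time_field (psi_ m) (phi_ m) V t y)|)%:E
            | y in W])%E.
apply: (@le_trans _ _ ((delta / C)%:E * I)%E).
  rewrite lee_pmul2l ?lte_fin ?divr_gt0//; apply: ereal_inf_lbound.
  exists (pullback_time_field (psi_ m) (phi_ m) V).
  exists (fun t y => phi_ m (Phi t (psi_ m y))); split=> //.
  - exact: time_fieldS cV1.
  - exact: is_flow_pullback.
  - apply/seteqP; split=> // _ [[x Ux <-] Nx].
    have [W1x] : (W1 `&` ~` F) (phi_ m (Phi 1 (psi_ m x))).
      apply: PFm; exists (Phi 1 (psi_ m x)) => //; exists (psi_ m x) => //.
      by apply: subset_closure; apply: Um; exists x.
    suff [] : (F `&` W) (phi_ m (Phi 1 (psi_ m x))) by [].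
    by rewrite -NF; split=> //; exact: W1W.
apply: ge0_scale_le_integral; first exact: divr_gt0.
  (* A supremum over the empty set would be [-oo]; the point [p] of [W] makes the integrand
     nonnegative. *)
  move=> t _; apply: le_trans (ereal_sup_ubound _); last by exists p => //; exact: W1W.
  by rewrite lee_fin.
move=> t; rewrite /= in_itv /= => t01.
apply: (pullback_sup_le (W1 := W1) (alpha := alpha) (f := f_ m) (y0 := psi p)) => //.
  by move=> y; exact: le_f.
by move=> y v; exact: pull.
Qed.

End EnergyComparison.

Unset Implicit Arguments.

Theorem proposition2p6 (R : realType) (n : nat) (Y : contactManifold R n)
    (N : set Y) (p : Y) (psi : Y -> Y)
    (hN : locally_closed N) (hp : N p) (hrigid : locally_rigid N p)
    (hpsi : contact_homeomorphism psi) (hbelow : bounded_below_near psi p) :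
  locally_rigid (psi @` N) (psi p).
Proof.
have [W [[oW Wp] _ NW rig]] := hrigid.
have [[cpsi [phi [cphi psiK phiK]]] _] := hpsi.
have [psi_ [B [[cpsi_ psi_cvg nB cB _] [G [G' [alpha [alpha' [f_ below]]]]]]]] := hbelow.
have {below} [[oG BG] [oG' BG'] [calpha calpha'] pull inf_gt0] := below.
have [phi_ phi_P] := choice (fun m => contactomorphism_inv (cpsi_ m)).
have homeo_image A : psi @` A = phi @^-1` A.
  apply/seteqP; split=> [_ [y Ay <-]|y Ay]; first by rewrite /= psiK.
  by exists (phi y) => //; rewrite phiK.
have closure_sub (A D : set Y) : A `<=` D -> compact D -> closure A `<=` D.
  move=> AD cD y /(closure_subset AD).
  exact: (compact_closed (@manifold_hausdorff _ _ Y) cD).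
(* [W] carries the rigidity hypothesis and [B] the bounds on [f_]; the compact [K] inside both is
   where all estimates take place. *)
have nWB : nbhs p (W `&` B°).
  by apply: filterI; [exact: open_nbhs_nbhs | exact: nbhs_interior].
have [K [pK cK _ KWB]] := manifold_compact_connected_nbhs nWB.
have KB : K `<=` closure B.
  by move=> y /KWB[_ /interior_subset]; exact: subset_closure.
pose W1 := K°.
have oW1 : open W1 by exact: open_interior.
have W1p : W1 p by exact: nbhs_singleton (nbhs_interior pK).
have W1K : W1 `<=` K by exact: interior_subset.
have W1W : W1 `<=` W by move=> y /W1K/KWB[].
have cpsiK : compact (psi @` K).
  by apply: continuous_compact => //; exact: continuous_subspaceT.
have clW' : closure (psi @` W1) `<=` psi @` K.
  by apply: closure_sub => // _ [y /W1K Ky <-]; exists y.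
have oW' : open (psi @` W1).
  by rewrite homeo_image; apply: open_comp => // y _; exact: cphi.
have cW' : compact (closure (psi @` W1)).
  exact: subclosed_compact (@closed_closure _ _) cpsiK clW'.
exists (psi @` W1); split=> //.
- have [F clF NF] := NW.
  exists (psi @` F).
    by rewrite homeo_image; apply: closed_comp => // y _; exact: cphi.
  rewrite !homeo_image -!preimage_setI; congr (_ @^-1` _).
  by rewrite -(setIidr W1W) !setIA NF.
move=> U' [oU' U'p] U'W'.
have cU' : compact (closure U').
  apply: subclosed_compact (@closed_closure _ _) cW' _.
  by apply: subset_trans U'W' _; exact: subset_closure.
have nU : nbhs p (psi @^-1` U').
  by apply: cpsi; exact: open_nbhs_nbhs.
have [K2 [pK2 cK2 _ K2U']] := manifold_compact_connected_nbhs nU.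
pose U := K2°.
have UK2 : closure U `<=` K2.
  by apply: closure_sub => //; exact: interior_subset.
have UW1 : closure U `<=` W1.
  move=> y /UK2/K2U' Uy; have : (psi @` W1) (psi y) by apply: U'W'; exact: subset_closure.
  by rewrite homeo_image /= psiK.
have pU : open_nbhs p U.
  by split; [exact: open_interior | exact: nbhs_singleton (nbhs_interior pK2)].
(* The rigidity form is given only after [U], so [alpha0] and [C] depend on [U']. This is harmless:
   for each [U'] only positivity of the energy is claimed. *)
have [alpha0 [calpha0 _] energy_gt0] := rig U pU (subset_trans UW1 W1W).
have [C C0 le_C] : exists2 C : R, 0 < C & forall y v, K y -> tangent y v ->
    `|alpha0 y v| <= C * `|alpha y v|.
  apply: (@contact_forms_comparable _ _ _ (W `&` G)) => //.
  - exact: openI.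
  - by apply: contact_form_onS calpha => y [].
  - by apply: contact_form_onS calpha0 => y [].
  - by move=> y Ky; split; [have [] := KWB y Ky | exact/BG/KB].
set S := [set r | _] in inf_gt0; pose delta := inf S.
(* The set [S] is bounded below by [0], so its real-valued [inf] is a genuine lower bound. *)
have le_f m y : K y -> delta <= `|f_ m y|.
  move=> Ky; apply: ge_inf; first by exists 0 => _ [m' [q [_ ->]]].
  by exists m, y; split=> //; exact: KB.
exists alpha'.
  apply: contact_form_rigidity calpha' _; apply: subset_trans clW' _.
  by apply: subset_trans BG'; exact: image_subset.
apply: (@lt_le_trans _ _ ((delta / C)%:E * disjunction_energy W alpha0 U N)%E).
  by apply: mule_gt0 => //; rewrite lte_fin divr_gt0.
apply: (@disjunction_energy_le _ _ _ psi_ phi_ psi phi _ _ _ _ _ _ _ _ W W1 U U' N p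
  alpha0 alpha alpha' f_ C delta) => //.
- by move=> m; have [] := phi_P m.
- by move=> m; have [] := phi_P m.
- by move=> m; have [] := phi_P m.
- exact: subclosed_compact (@closed_closure _ _) cK2 UK2.
- by move=> _ [y /UK2/K2U' Uy <-].
- by move=> y Wy; have [sA _] := calpha0; have [] := sA y Wy.
- by move=> y v /W1K; exact: le_C.
- by move=> m y /W1K; exact: le_f.
- by move=> m y v /W1K/KB By tv; have [_] := pull m y By; exact.
Qed.
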